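(* Let $a$ be a parameter and let $\omega$ be a root of $36z^2+(9a-30)z+3a+1$. The general embedded commutator-free Runge-Kutta pair of order 3(2) (with the ''first same as last'' property) that reuses the exponential of the third stage as the second exponential of the update $y_{n+1}$ is $$g_1=e,\quad g_2=\exp(h\,a f_1),\quad g_3=\exp\Big(h\Big(\tfrac{6a\omega-3\omega-a}{3a}f_1+\tfrac{\omega}{a}f_2\Big)\Big),\quad f_r=f(\Lambda(g_r,p))\ (r=1,2,3),$$ $$y_{n+1}=\Lambda\Big(\exp\Big(h\Big(\tfrac{6a\omega-3\omega-a}{3a}f_1+\tfrac{\omega}{a}f_2\Big)\Big)\exp\big(h(\beta_1^1f_1+\beta_1^2f_2+\beta_1^3f_3)\big),p\Big),$$ where $$\beta_1^1=\frac{-12a\omega-18\omega-11a+11}{6},\qquad \beta_1^2=\frac{18\omega(1-a)-11}{6a(3a+1)},\qquad \beta_1^3=\frac{-12\omega+3a-10}{2(3a+1)},$$ with third-stage abscissa $c_3=\frac{6\omega-1}{3}$ (the sum of the two coefficients in $g_3$), together with an embedded approximation $$\hat y_{n+1}=\Lambda\Big(\exp\Big(h\sum_{k=1}^4\hat\beta^kf_k\Big),p\Big),\qquad f_4=f(y_{n+1}).$$ Once $a$ is chosen and a consistent choice of the root $\omega=\omega(a)$ is made, the order 2 conditions for $\hat y_{n+1}$ (which coincide with the classical second-order Runge-Kutta conditions) form a system of two linear equations for the four coefficients $\hat\beta^1,\dots,\hat\beta^4$, in general resulting in a two-parameter family once the rest of the scheme is set. In general the coefficients are irrational, but some choices of $a$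 give rational coefficients, for instance $a=-\tfrac13,\tfrac13,\tfrac23,\tfrac79,\tfrac{101}{9},\tfrac{34}{3},\tfrac{35}{3}$; in general these can be found by setting the discriminant $81a^2-972a+756$ to be a square.
   Context: Setting. Let $G$ be a Lie group with Lie algebra $\mathfrak g$ and identity $e$, $M$ a manifold, $\Lambda:G\times M\to M$ a group action with infinitesimal action $\lambda_*(u)(q)=\frac{d}{dt}\big|_{t=0}\Lambda(\exp(tu),q)$, $u\in\mathfrak g$, and $f:M\to\mathfrak g$. The scheme approximates the solution of $y'=\big(\lambda_*f(y)\big)(y)$ with step size $h$ starting from the point $p=y_n\in M$. Order. Let $\hat\varphi_h:M\to M$ be the map corresponding to one step of a method ($y_{n+1}$ or $\hat y_{n+1}$ as a function of $p$) and $\varphi_h$ the map which flows for time $h$ along the exact solution. The method has order $q$ if $\psi(\varphi_h(p))-\psi(\hat\varphi_h(p))=\mathcal O(h^{q+1})$ for all $C^\infty$ functions $\psi$ on $M$. An embedded pair of order 3(2) consists of $y_{n+1}$ of order 3 and $\hat y_{n+1}$ of order 2 sharing the same stages; ''first same as last'' means that $\hat y_{n+1}$ may use $f(y_{n+1})$, which is the first function evaluation of the next step.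
   Formalization: The printed β's fail (a=2/3, ω=1/2: weights sum to -35/9, not 1); proved instead with β^1=(-12aω+18ω+11a-11)/(6a), β^2=(-18ω(1+a)+11)/(6a(3a+1)), β^3=(-12ω-3a+10)/(2(3a+1)); a=-1/3, where β^2, β^3 become 0/0, gets its own coefficients. *)

(* Defs.v *)
From mathcomp Require Import all_boot all_order all_algebra.
From mathcomp Require Import all_classical all_reals all_analysis.

Set Implicit Arguments.
Unset Strict Implicit.
Unset Printing Implicit Defensive.

Import Order.TTheory GRing.Theory Num.Theory.
Import numFieldNormedType.Exports.
Local Open Scope classical_set_scope.
Local Open Scope ring_scope.

(* [V] is meant to be finite-dimensional: there, a map is C^(k+1) iff it is   *)
(* differentiable and all the maps x |-> 'd f x v are C^k.                    *)
Fixpoint Ck_on (R : realType) (V W : normedModType R) (k : nat) (U : set V)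
    (f : V -> W) : Prop :=
  if k is k'.+1 then
    (forall x, U x -> differentiable f x) /\
    (forall v, Ck_on k' U (fun x => 'd f x v))
  else forall x, U x -> {for x, continuous f}.

Definition smooth_on (R : realType) (V W : normedModType R) (U : set V)
  (f : V -> W) : Prop := forall k, Ck_on k U f.

(* [fwd] and [bwd] are total functions that are only meaningful on [dom] and  *)
(* [img].                                                                     *)
Record chart (R : realType) (M : topologicalType) (n : nat) := Chart {
  dom : set M;
  img : set 'rV[R]_n;
  fwd : M -> 'rV[R]_n;
  bwd : 'rV[R]_n -> M;
  dom_open : open dom;
  img_open : open img;
  fwd_img : forall q, dom q -> img (fwd q);
  bwd_dom : forall x, img x -> dom (bwd x);
  fwdK : forall q, dom q -> bwd (fwd q) = q;
  bwdK : forall x, img x -> fwd (bwd x) = x;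
  fwd_continuous : forall q, dom q -> {for q, continuous fwd};
  bwd_continuous : forall x, img x -> {for x, continuous bwd} }.

Record manifold (R : realType) := Manifold {
  carrier :> topologicalType;
  mdim : nat;
  atlas : set (chart R carrier mdim);
  manifold_hausdorff : hausdorff_space carrier;
  manifold_second_countable : @second_countable carrier;
  atlas_cover : forall q, exists2 c, atlas c & dom c q;
  atlas_compatible : forall c d, atlas c -> atlas d ->
    smooth_on (img c `&` bwd c @^-1` dom d) (fwd d \o bwd c) }.

Section SmoothMaps.
Context {R : realType}.

Definition smooth_fun (M : manifold R) (V : normedModType R) (f : M -> V) :=
  forall c, atlas c -> smooth_on (img c) (f \o bwd c).

Definition smooth_curve (M : manifold R) (y : R -> M) :=
  continuous y /\
  forall c, atlas c -> smooth_on (y @^-1` dom c) (fwd c \o y).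

Definition smooth_map (M N : manifold R) (F : M -> N) :=
  continuous F /\
  forall c d, atlas c -> atlas d ->
    smooth_on (img c `&` (F \o bwd c) @^-1` dom d) (fwd d \o F \o bwd c).

(* Smoothness of a map from the product manifold, read in product charts.     *)
Definition smooth_map2 (M N P : manifold R) (F : M -> N -> P) :=
  continuous (fun z : M * N => F z.1 z.2) /\
  forall c d k, atlas c -> atlas d -> atlas k ->
    let Fcd (z : 'rV[R]_(mdim M) * 'rV[R]_(mdim N)) :=
      F (bwd c z.1) (bwd d z.2) in
    smooth_on ((img c `*` img d) `&` Fcd @^-1` dom k) (fwd k \o Fcd).

End SmoothMaps.

Record lieGroup (R : realType) := LieGroup {
  lg_manifold :> manifold R;
  lg_mul : lg_manifold -> lg_manifold -> lg_manifold;
  lg_inv : lg_manifold -> lg_manifold;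
  lg_one : lg_manifold;
  lg_mulA : associative lg_mul;
  lg_mul1 : left_id lg_one lg_mul;
  lg_mulV : left_inverse lg_one lg_inv lg_mul;
  lg_mul_smooth : smooth_map2 lg_mul;
  lg_inv_smooth : smooth_map lg_inv;
  (* an arbitrary chart around the identity, used to write down T_e G *)
  lg_chart : chart R lg_manifold (mdim lg_manifold);
  lg_chart_atlas : atlas lg_chart;
  lg_chart_one : dom lg_chart lg_one }.

Section LieGroups.
Context {R : realType}.

(* The Lie algebra is the tangent space at the identity, identified with the  *)
(* coordinate space by the differential of [lg_chart]; the bracket plays no   *)
(* role below.                                                                *)
Definition lieAlg (G : lieGroup R) := 'rV[R]_(mdim G).

(* The exponential map is the unique map [E] such that t |-> E (t u) is the   *)
(* one-parameter subgroup with initial velocity u.                            *)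
Definition is_exponential (G : lieGroup R) (E : lieAlg G -> G) :=
  forall u : lieAlg G,
    [/\ smooth_curve (fun t : R => E (t *: u)),
        forall s t : R, E ((s + t) *: u) = lg_mul (E (s *: u)) (E (t *: u)) &
        is_derive (0 : R) 1 (fun t : R => fwd (lg_chart G) (E (t *: u))) u].

Definition is_action (G : lieGroup R) (M : manifold R) (L : G -> M -> M) :=
  [/\ forall q, L (lg_one G) q = q,
      forall g k q, L (lg_mul g k) q = L g (L k q) &
      smooth_map2 L].

End LieGroups.

(* A Lie group acting on a manifold, together with f : M -> g.                *)
Record problem (R : realType) := Problem {
  grp : lieGroup R;
  gexp : lieAlg grp -> grp;
  gexpP : is_exponential gexp;
  mfd : manifold R;
  act : grp -> mfd -> mfd;
  actP : is_action act;
  rhs : mfd -> lieAlg grp;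
  rhs_smooth : smooth_fun (V := 'rV[R]_(mdim grp)) rhs }.

Section Order.
Context {R : realType}.

(* The tangent vector lambda_*(u)(q), in the coordinates of the chart [c].    *)
Definition inf_action (P : problem R) (c : chart R (mfd P) (mdim (mfd P)))
    (u : lieAlg (grp P)) (q : mfd P) : 'rV[R]_(mdim (mfd P)) :=
  derive1 (fun t : R => fwd c (act (gexp (t *: u)) q)) 0.

(* [y] is, for small times, the solution of y' = (lambda_* f(y))(y) starting  *)
(* from [p], i.e. y h is the point reached from p by the exact flow.          *)
Definition exact_solution (P : problem R) (p : mfd P) (y : R -> mfd P) :=
  y 0 = p /\
  \forall t \near (0 : R), {for t, continuous y} /\
    forall c, atlas c -> dom c (y t) ->
      is_derive t 1 (fwd c \o y) (inf_action c (rhs (y t)) (y t)).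

Definition method := forall P : problem R, R -> mfd P -> mfd P.

Definition has_order (q : nat) (step : method) :=
  forall (P : problem R) (p : mfd P) (y : R -> mfd P) (psi : mfd P -> R),
    exact_solution p y -> smooth_fun psi ->
    (fun h : R => psi (y h) - psi (step P h p)) =O_ (0 : R)
      (fun h : R => h ^+ q.+1).

End Order.

(* g_2 = exp(h a f_1), g_3 = exp(h (al1 f_1 + al2 f_2)), and the update has   *)
(* exponents h (al1 f_1 + al2 f_2) and h (be1 f_1 + be2 f_2 + be3 f_3).       *)
Record cfcoef (R : realType) := CFCoef {
  ca : R; al1 : R; al2 : R; be1 : R; be2 : R; be3 : R }.

Section Scheme.
Context {R : realType}.
Implicit Types (C : cfcoef R) (P : problem R).

Definition stage1 P (h : R) (p : mfd P) : lieAlg (grp P) :=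
  rhs (act (lg_one (grp P)) p).

Definition stage2 C P h (p : mfd P) : lieAlg (grp P) :=
  rhs (act (gexp (h *: (ca C *: stage1 h p))) p).

Definition g3 C P h (p : mfd P) : grp P :=
  gexp (h *: (al1 C *: stage1 h p + al2 C *: stage2 C h p)).

Definition stage3 C P h (p : mfd P) : lieAlg (grp P) :=
  rhs (act (g3 C h p) p).

Definition update C : method := fun P h p =>
  act (lg_mul (g3 C h p)
         (gexp (h *: (be1 C *: stage1 h p + be2 C *: stage2 C h p
                      + be3 C *: stage3 C h p)))) p.

Definition stage4 C P h (p : mfd P) : lieAlg (grp P) :=
  rhs (update C h p).

Definition embedded C (bh : 'rV[R]_4) : method := fun P h p =>
  act (gexp (h *: (bh 0 0 *: stage1 h p + bh 0 1 *: stage2 C h p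
                   + bh 0 2 *: stage3 C h p + bh 0 3 *: stage4 C h p))) p.

Definition omega_poly (a : R) : {poly R} :=
  36 *: 'X^2 + (9 * a - 30) *: 'X + (3 * a + 1)%:P.

(* The formulas for be1, be2, be3 correct misprints of the published ones,    *)
(*   be1 = (- 12 a w - 18 w - 11 a + 11) / 6,                                 *)
(*   be2 = (18 w (1 - a) - 11) / (6 a (3 a + 1)),                             *)
(*   be3 = (- 12 w + 3 a - 10) / (2 (3 a + 1)),                               *)
(* which violate even al1 + al2 + be1 + be2 + be3 = 1 (a = 2/3, w = 1/2).     *)
Definition general_coef (w : R) C : Prop :=
  let a := ca C in
  [/\ al1 C = (6 * a * w - 3 * w - a) / (3 * a),
      al2 C = w / a,
      be1 C = (- 12 * a * w + 18 * w + 11 * a - 11) / (6 * a),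
      be2 C = (- 18 * w * (1 + a) + 11) / (6 * a * (3 * a + 1)) &
      be3 C = (- 12 * w - 3 * a + 10) / (2 * (3 * a + 1))].

(* For a = -1/3 the roots w are 0 and 11/12. The value w = 0 is excluded by   *)
(* the order conditions; for w = 11/12 the formulas for be2 and be3 read 0/0, *)
(* and the values below are the ones that satisfy the order conditions.       *)
Definition special_coef C : Prop :=
  [/\ al1 C = 17 / 4, al2 C = - 11 / 4,
      be1 C = - 11 / 4, be2 C = 91 / 44 & be3 C = 2 / 11].

(* Abscissae of f_1, ..., f_4; the last one is 1 because f_4 = f(y_{n+1}).    *)
Definition abscissae C : 'rV[R]_4 :=
  \row_k nth 0 [:: 0; ca C; al1 C + al2 C; 1] k.

Definition classical_order2 (b c : 'rV[R]_4) : Prop :=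
  \sum_k b 0 k = 1 /\ \sum_k b 0 k * c 0 k = 1 / 2.

Definition is_rational (x : R) := exists r : rat, x = ratr r.

Definition rational_coef C :=
  [/\ is_rational (ca C), is_rational (al1 C) & is_rational (al2 C)] /\
  [/\ is_rational (be1 C), is_rational (be2 C) & is_rational (be3 C)].

End Scheme.

(* Main.v *)
(* In a chart around the starting point, the infinitesimal action becomes a   *)
(* family of vector fields depending linearly on u, and exp(tu) acts by the   *)
(* flow of the field of u. Taylor's formula along the two flows of the update *)
(* expands a test function psi in terms of iterated Lie derivatives of psi    *)
(* and f, whose coefficients agree with those of the exact solution up to h^3 *)
(* iff, with c3 = al1 + al2 and b_i the total weight of f_i,                  *)
(*   sum b_i = 1, b2 a + b3 c3 = 1/2, b2 a^2 + b3 c3^2 = 1/3,                 *)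
(*   b3 al2 a = 1/6, 6 al2 a = 1 + 3 c3,                                      *)
(* the last condition being the only one that comes from noncommutativity.    *)
(* Necessity is read off one polynomial problem on the product of the         *)
(* Heisenberg group and the plane. The conditions are then solved in terms of *)
(* a and w = al2 a.                                                           *)
From HB Require Import structures.
Require Import Defs.
From mathcomp Require Import all_boot all_order all_algebra.
From mathcomp Require Import all_classical all_reals all_analysis.
From mathcomp Require Import ring lra.

Set Implicit Arguments.
Unset Strict Implicit.
Unset Printing Implicit Defensive.

Import Order.TTheory GRing.Theory Num.Theory.
Import numFieldNormedType.Exports.
Local Open Scope classical_set_scope.
Local Open Scope ring_scope.

(** * Calculus of smooth maps *)

(** In a chart, exp(tu) acts by the flow of a field linear in u. The time derivatives of a test
    function along such flows are therefore iterated Lie derivatives, that is, multilinear forms in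
    the exponents, without symmetry because the fields need not commute. The exponents depend on the
    step size h, so flows are confined to a chart ([curve_stays]) and expanded with remainders
    uniform in h ([taylor_flow]). The exact solution is expanded in the same forms ([taylor_exact]),
    and [double_flow_ex4] treats the two successive flows of the update. Comparing powers of h shows
    that the order conditions suffice ([order3_sufficient], [order2_sufficient]).

    Let s, t be the total weights of the two exponents of the update, and A, B the factors of their
    terms h f'f. At h^3 the derivatives along f and f'f, taken in the two possible orders, must get
    the coefficients 1/3 and 1/6. Their sum is already right when s + t = 1 and A + B = 1/2;
    separating them costs the extra condition 6 A = 1 + 3 s.

    Conversely, for [test_problem] each coordinate of the exact solution and of the update from the
    origin is a single monomial in h, and the five coordinates return the five conditions
    ([order3_necessary]).

    With w = [al2] a, the conditions express c3 and b3 through w, and eliminating b2 between the two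
    conditions on sum b_i c_i and sum b_i c_i^2 leaves the quadratic for w ([order3_solved]). If 3a
    + 1 is nonzero, the quadratic turns 1/(6w) into a fraction over 3a + 1, which yields the stated
    formulas ([order3_general], [general_order3]); a = -1/3 is solved apart ([order3_special]). All
    coefficients are rational in a and w, so for rational a they are rational exactly when the
    discriminant is a rational square ([rational_coefP]). *)

Section Smooth.
Context {R : realType}.
Implicit Types U V W : normedModType R.

(** The remainder of the expansion of [f] at [x] also serves for [g], and a differential is
    determined by such an expansion. This locality lets later identities be checked on an open set
    only. *)
Lemma near_eq_diff V W (f g : V -> W) (x : V) :
  (\forall y \near x, f y = g y) -> differentiable f x ->
  differentiable g x /\ 'd g x = 'd f x :> (V -> W).
Proof.
move=> fg df.
have dgx : g \o shift x = cst (g x) + 'd f x +o_ 0 id.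
  apply/eqaddoP => e e0; have /eqaddoP/(_ e e0) := diff_locally df.
  have gf0 : \forall h \near (0 : V), f (h + x) = g (h + x).
    by move: fg; rewrite (near_shift 0 x) subr0.
  move=> dfe; near=> h => /=.
  have fghx : f (h + x) = g (h + x) by near: h.
  have -> : ((g \o shift x) - (cst (g x) + 'd f x)) h =
    ((f \o shift x) - (cst (f x) + 'd f x)) h.
    rewrite /= -[LHS]/(g (h + x) - (g x + 'd f x h)).
    rewrite -[RHS]/(f (h + x) - (f x + 'd f x h)).
    by rewrite fghx (nbhs_singleton fg).
  by near: h.
have dgE : 'd g x = 'd f x :> (V -> W).
  by apply: diff_unique dgx; exact: diff_continuous.
split=> //; apply/diff_locallyP; rewrite dgE; split => //.
exact: diff_continuous.
Unshelve. all: by end_near. Qed.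

Lemma open_near V (D : set V) (P : V -> Prop) x :
  open D -> D x -> (forall y, D y -> P y) -> \forall y \near x, P y.
Proof.
move=> oD Dx DP; apply: (filterS (P := D)) => //.
by apply: open_nbhs_nbhs; split.
Qed.

Lemma Ck_on_ext V W k (D : set V) (f g : V -> W) : open D ->
  (forall x, D x -> f x = g x) -> Ck_on k D f -> Ck_on k D g.
Proof.
elim: k f g => [|k IH] f g oD fg.
  move=> cf x Dx; rewrite /prop_for /continuous_at -(fg _ Dx).
  apply: (cvg_trans _ (cf x Dx)); apply: near_eq_cvg.
  exact: (open_near oD Dx).
move=> [df Hf].
have dfg x : D x -> differentiable g x /\ 'd g x = 'd f x :> (V -> W).
  by move=> Dx; apply: near_eq_diff; [exact: (open_near oD Dx)|exact: df].
split=> [x /dfg[]//|v]; apply: (IH _ _ oD _ (Hf v)) => x /dfg[_].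
by move=> /(congr1 (fun h => h v))/esym.
Qed.

Lemma Ck_onS V W k (D E : set V) (f : V -> W) :
  D `<=` E -> Ck_on k E f -> Ck_on k D f.
Proof.
move=> DE; elim: k f => [|k IH] f /=; first by move=> H x /DE/H.
by move=> [H1 H2]; split=> [x /DE/H1|v] //; apply: IH.
Qed.

Lemma Ck_on_pred V W k (D : set V) (f : V -> W) : Ck_on k.+1 D f -> Ck_on k D f.
Proof.
elim: k f => [|k IH] f /=.
  by move=> [df _] x /df /differentiable_continuous.
by move=> [df H]; split => // v; apply: IH; have [] := H v.
Qed.

Lemma Ck_on_cst V W k (D : set V) (a : W) : Ck_on k D (fun=> a).
Proof.
elim: k a => [|k IH] a /=; first by move=> x _; exact: cst_continuous.
split=> [x _|v]; first exact: differentiable_cst.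
have -> : (fun x : V => 'd (fun=> a) x v) = fun=> 0 :> W.
  by apply/funext => x; exact: (congr1 (fun h => h v) (diff_cst a x)).
exact: IH.
Qed.

Lemma Ck_on_lin V W k (D : set V) (f : {linear V -> W}) :
  continuous f -> Ck_on k D f.
Proof.
case: k => [|k] cf; first by move=> x _; exact: cf.
split=> [x _|v]; first exact: linear_differentiable.
have -> : (fun x => 'd f x v) = fun=> f v by apply/funext => x; rewrite diff_lin.
exact: Ck_on_cst.
Qed.

Lemma Ck_on_linear_comp U V W k (D : set U) (f : U -> V) (L : {linear V -> W}) :
  open D -> continuous L -> Ck_on k D f -> Ck_on k D (L \o f).
Proof.
move=> oD cL; elim: k f => [|k IH] f.
  by move=> cf x /cf fx; apply: continuous_comp => //; exact: cL.
move=> [df Hf]; split=> [x /df dfx|v].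
  by apply: differentiable_comp => //; exact: linear_differentiable.
apply: Ck_on_ext (IH _ (Hf v)) => // x /df dfx.
rewrite diff_comp //=; last exact: linear_differentiable.
by rewrite diff_lin.
Qed.

Lemma Ck_onD V W k (D : set V) (f g : V -> W) : open D ->
  Ck_on k D f -> Ck_on k D g -> Ck_on k D (fun x => f x + g x).
Proof.
move=> oD; elim: k f g => [|k IH] f g.
  by move=> cf cg x Dx; apply: continuousD; [exact: cf|exact: cg].
move=> [df Hf] [dg Hg]; split=> [x Dx|v].
  by apply: differentiableD; [exact: df|exact: dg].
apply: Ck_on_ext (IH _ _ (Hf v) (Hg v)) => // x Dx.
by have /(congr1 (fun h => h v))/esym := diffD (df _ Dx) (dg _ Dx).
Qed.

Lemma Ck_onM V k (D : set V) (f g : V -> R) : open D ->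
  Ck_on k D f -> Ck_on k D g -> Ck_on k D (fun x => f x * g x).
Proof.
move=> oD; elim: k f g => [|k IH] f g.
  by move=> cf cg x Dx; apply: continuousM; [exact: cf|exact: cg].
move=> Cf Cg; have [df Hf] := Cf; have [dg Hg] := Cg; split=> [x Dx|v].
  by apply: differentiableM; [exact: df|exact: dg].
(* The product rule multiplies derivatives by [f] and [g] themselves, whose regularity is lowered to
   match. *)
have := Ck_onD oD (IH _ _ (Ck_on_pred Cf) (Hg v)) (IH _ _ (Ck_on_pred Cg) (Hf v)).
apply: Ck_on_ext => // x Dx.
by have /(congr1 (fun h => h v))/esym := diffM (df _ Dx) (dg _ Dx).
Qed.

Lemma Ck_onZl V W k (D : set V) (f : V -> R) (w : W) : open D ->
  Ck_on k D f -> Ck_on k D (fun x => f x *: w).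
Proof.
move=> oD; elim: k f => [|k IH] f.
  by move=> cf x Dx; apply: continuousZr_tmp; exact: cf.
move=> [df Hf]; split=> [x Dx|v].
  by apply: differentiableZl; exact: df.
apply: Ck_on_ext (IH _ (Hf v)) => // x Dx.
by have /(congr1 (fun h => h v))/esym := diffZl w (df _ Dx).
Qed.

Lemma Ck_on_sum V W k (D : set V) I (r : seq I) (f : I -> V -> W) : open D ->
  (forall i, Ck_on k D (f i)) -> Ck_on k D (fun x => \sum_(i <- r) f i x).
Proof.
move=> oD Hf; elim: r => [|i r IH].
  apply: Ck_on_ext (Ck_on_cst k D (0 : W)) => // x _; by rewrite big_nil.
apply: Ck_on_ext (Ck_onD oD (Hf i) IH) => // x _; by rewrite big_cons.
Qed.



(** The inclusion of the slice has the constant differential v |-> (0, v). Freezing the group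
    coordinate at the identity will make the fundamental fields smooth. *)
Lemma Ck_on_slice U V W k (E : set (U * V)) (D : set V) (u0 : U)
    (f : U * V -> W) : open D -> (forall x, D x -> E (u0, x)) ->
  Ck_on k E f -> Ck_on k D (fun x => f (u0, x)).
Proof.
move=> oD DE; elim: k f => [|k IH] f.
  move=> cf x Dx.
  apply: (@continuous_comp _ _ _ (fun x => (u0, x)) f); last exact/cf/DE.
  by apply: cvg_pair => //=; exact: cvg_cst.
move=> [df Hf].
have dpr x : is_diff x (fun x : V => (u0, x)) (fun v => (0, v)).
  by apply: is_diff_pair.
split=> [x Dx|v].
  apply: (@differentiable_comp _ _ _ _ (fun x => (u0, x)) f) => //.
  exact/df/DE.
apply: Ck_on_ext (IH _ (Hf (0, v))) => // x Dx.
have := @diff_comp _ _ _ _ (fun x => (u0, x)) f x (@ex_diff _ _ _ _ _ _ _ (dpr x)) (df _ (DE _ Dx)).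
move=> /(congr1 (fun h => h v)) /= ->.
by rewrite diff_val.
Qed.

Lemma smooth_on_diff V W (D : set V) (f : V -> W) v :
  smooth_on D f -> smooth_on D (fun x => 'd f x v).
Proof. by move=> Cf k; have [_] := Cf k.+1; exact. Qed.

Lemma smooth_on_differentiable V W (D : set V) (f : V -> W) x :
  smooth_on D f -> D x -> differentiable f x.
Proof. by move=> Cf; have [+ _] := Cf 1%N; exact. Qed.

Lemma smooth_on_continuous V W (D : set V) (f : V -> W) x :
  smooth_on D f -> D x -> {for x, continuous f}.
Proof. by move=> Cf; have := Cf 0%N; exact. Qed.

Lemma smooth_on_coord V (D : set V) n (f : V -> 'rV[R]_n) j : open D ->
  smooth_on D f -> smooth_on D (fun x => f x 0 j).
Proof.
move=> oD Cf k.
pose c (y : 'rV[R]_n) := y 0 j.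
have cl : linear c by move=> a y z; rewrite /c !mxE.
pose L : {linear 'rV[R]_n -> R} := HB.pack c (GRing.isLinear.Build _ _ _ _ c cl).
exact: (Ck_on_linear_comp (L := L) oD (@coord_continuous R 1 n 0 j)).
Qed.

Lemma diff_rVE W n (f : 'rV[R]_n -> W) x v :
  'd f x v = \sum_j v 0 j *: 'd f x (delta_mx 0 j).
Proof.
rewrite {1}(row_sum_delta v) linear_sum; apply: eq_bigr => j _.
by rewrite linearZ.
Qed.

(** [Ck_on] only speaks of derivatives in fixed directions, so the moving direction is expanded in
    the standard basis. *)
Lemma smooth_on_diff_field n (D : set 'rV[R]_n) (f : 'rV[R]_n -> R)
    (X : 'rV[R]_n -> 'rV[R]_n) : open D -> smooth_on D f ->
  (forall j, smooth_on D (fun x => X x 0 j)) ->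
  smooth_on D (fun x => 'd f x (X x)).
Proof.
move=> oD Cf CX k.
pose g x := \sum_j X x 0 j * 'd f x (delta_mx 0 j).
have : Ck_on k D g.
  by apply: Ck_on_sum => // j; apply: Ck_onM => //; [exact: CX|exact: smooth_on_diff].
by apply: Ck_on_ext => // x _; rewrite /g [RHS]diff_rVE.
Qed.

End Smooth.

(** * Taylor's formula and confinement of curves *)

Section OneVariable.
Context {R : realType}.

Lemma mean_value_ge0 (f df : R -> R) (t K : R) : 0 <= t ->
  (forall s : R, 0 <= s <= t -> is_derive s 1 f (df s)) ->
  (forall s, 0 <= s <= t -> `|df s| <= K) -> `|f t - f 0| <= K * t.
Proof.
move=> t0 Hf HK.
have [s st ->] : exists2 s, s \in `[0, t]%R & f t - f 0 = df s * (t - 0).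
  apply: (MVT_segment t0).
    by move=> s; rewrite in_itv /= => /andP[/ltW s0 /ltW st]; apply: Hf; rewrite s0.
  apply: derivable_within_continuous => s; rewrite in_itv /= => st.
  by have [] := Hf _ st.
by rewrite subr0 normrM (ger0_norm t0) ler_wpM2r // HK.
Qed.

Lemma diff1 (V : normedModType R) (f : R -> V) (s : R) (l : V) :
  is_derive s 1 f l -> differentiable f s /\ 'd f s (1 : R) = l.
Proof.
move=> [/derivable1_diffP df <-]; split=> //.
by rewrite (deriveE (1 : R) df).
Qed.

Lemma is_derive_comp (V W : normedModType R) (f : R -> V) (F : V -> W) (s : R) l :
  differentiable F (f s) -> is_derive s 1 f l ->
  is_derive s 1 (F \o f) ('d F (f s) l).
Proof.
move=> dF /diff1[df fl].
have dc : differentiable (F \o f) s by exact: differentiable_comp.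
apply: DeriveDef; first exact/derivable1_diffP.
by rewrite (deriveE (1 : R) dc) (diff_comp df dF) /= fl.
Qed.

Lemma is_derive_opp_arg (V : normedModType R) (f : R -> V) (s : R) (l : V) :
  is_derive (- s) 1 f l -> is_derive s 1 (fun r => f (- r)) (- l).
Proof.
move=> /diff1[df fl].
have dN : is_derive s 1 (fun r : R => - r) (- 1) by exact: is_deriveNid.
have := is_derive_comp (f := fun r : R => - r) (F := f) df dN.
by rewrite linearN fl.
Qed.

Lemma mean_value_bound (f df : R -> R) (t K : R) :
  (forall s : R, `|s| <= `|t| -> is_derive s 1 f (df s)) ->
  (forall s, `|s| <= `|t| -> `|df s| <= K) -> `|f t - f 0| <= K * `|t|.
Proof.
move=> Hf HK; have [t0|/ltW t0] := leP 0 t.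
  rewrite [X in _ <= _ * X]ger0_norm //.
  apply: (@mean_value_ge0 f df) => // s /andP[s0 st].
    by apply: Hf; rewrite !ger0_norm.
  by apply: HK; rewrite !ger0_norm.
have := @mean_value_ge0 (fun s => f (- s)) (fun s => - df (- s)) (- t) K.
rewrite opprK oppr0 [X in _ -> _ <= _ * X]ler0_norm //.
have nrm s : 0 <= s <= - t -> `|- s| <= `|t|.
  by move=> /andP[s0 st]; rewrite normrN ger0_norm // ler0_norm.
apply; first by rewrite oppr_ge0.
  by move=> s /nrm st; apply: is_derive_opp_arg; exact: Hf.
by move=> s /nrm st; rewrite normrN; exact: HK.
Qed.

Definition taylor_poly (k : nat) (a : nat -> R) (t : R) : R :=
  \sum_(j < k) t ^+ j / j`!%:R * a j.

Lemma is_derive_taylor_poly k a (s : R) :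
  is_derive s 1 (taylor_poly k.+1 a) (taylor_poly k (fun j => a j.+1) s).
Proof.
elim: k => [|k IH].
  rewrite /taylor_poly big_ord0.
  have -> : (fun t : R => \sum_(j < 1) t ^+ j / j`!%:R * a j) = cst (a 0%N).
    by apply/funext => t; rewrite big_ord1 expr0 fact0 divr1 mul1r.
  exact: is_derive_cst.
have dX : is_derive s 1 (fun t : R => t ^+ k.+1) (k.+1%:R * s ^+ k).
  apply: DeriveDef; first exact: exprn_derivable.
  by rewrite exp_derive /= -[LHS]/(_ * 1) mulr1.
have -> : taylor_poly k.+2 a =
    taylor_poly k.+1 a + ((k.+1)`!%:R^-1 * a k.+1) *: (fun t : R => t ^+ k.+1).
  apply/funext => t; rewrite /taylor_poly big_ord_recr /=.
  rewrite -[RHS]/(taylor_poly k.+1 a t + ((k.+1)`!%:R^-1 * a k.+1) * t ^+ k.+1).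
  by rewrite /taylor_poly -mulrA [X in _ + X]mulrC.
have -> : taylor_poly k.+1 (fun j => a j.+1) s =
    taylor_poly k (fun j => a j.+1) s + ((k.+1)`!%:R^-1 * a k.+1) *: (k.+1%:R * s ^+ k).
  rewrite /taylor_poly big_ord_recr /=; congr (_ + _).
  rewrite -[RHS]/(_ * _) factS natrM.
  have k0 : (k.+1%:R : R) != 0 by [].
  have kf : (k`!%:R : R) != 0 by rewrite pnatr_eq0 -lt0n fact_gt0.
  by field; rewrite kf addrC -natr1 in k0 *.
by apply: is_deriveD => //; exact: is_deriveZ.
Qed.

(** The remainder of [g 0] vanishes at 0 and its derivative is the remainder of [g 1] at one order
    less; induction and the mean value inequality conclude. The constant is the bound on [g k]
    itself, hence uniform whenever that bound is. *)
Lemma taylor_bound k (g : nat -> R -> R) (t C : R) :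
  (forall j (s : R), (j < k)%N -> `|s| <= `|t| -> is_derive s 1 (g j) (g j.+1 s)) ->
  (forall s, `|s| <= `|t| -> `|g k s| <= C) ->
  `|g 0%N t - taylor_poly k (g ^~ 0) t| <= C * `|t| ^+ k.
Proof.
elim: k g t => [|k IH] g t Hg HC.
  by rewrite /taylor_poly big_ord0 subr0 expr0 mulr1; exact: HC.
have C0 : 0 <= C by apply: le_trans (HC 0 _); rewrite ?normr_ge0 // normr0.
pose f s := g 0%N s - taylor_poly k.+1 (g ^~ 0) s.
pose df s := g 1%N s - taylor_poly k (fun j => g j.+1 0) s.
have f0 : f 0 = 0.
  rewrite /f /taylor_poly big_ord_recl /= expr0 fact0 divr1 mul1r.
  by rewrite big1 ?addr0 ?subrr // => i _; rewrite expr0n /= !mul0r.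
rewrite -[X in `|X|]/(f t) -[f t]subr0 -f0 exprSr mulrA.
apply: (@mean_value_bound f df) => s st.
  by apply: is_deriveB; [exact: Hg|exact: is_derive_taylor_poly].
apply: le_trans (IH (fun j => g j.+1) s _ _) _.
- by move=> j r jk rs; apply: Hg => //; exact: le_trans rs st.
- by move=> r rs; apply: HC; exact: le_trans rs st.
by rewrite ler_wpM2l // lerXn2r ?nnegrE.
Qed.

Lemma le_mx_norm m n (A : 'M[R]_(m, n)) i j : `|A i j| <= `|A|.
Proof.
rewrite [leRHS]/Num.Def.normr /= mx_normrE.
exact: (@le_bigmax _ _ _ _ (fun ij : 'I_m * 'I_n => `|A ij.1 ij.2|) (i, j)).
Qed.

Lemma mx_norm_le m n (A : 'M[R]_(m, n)) (K : R) : 0 <= K ->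
  (forall i j, `|A i j| <= K) -> `|A| <= K.
Proof.
move=> K0 HA; rewrite [leLHS]/Num.Def.normr /= mx_normrE.
by apply: bigmax_le => // -[i j] _; exact: HA.
Qed.

Lemma is_derive_coord n (f : R -> 'rV[R]_n) (s : R) l j :
  is_derive s 1 f l -> is_derive s 1 (fun t => f t 0 j) (l 0 j).
Proof.
move=> [df <-]; apply: DeriveDef; first by have /derivable_mxP := df; exact.
by rewrite derive_mx // mxE.
Qed.

Lemma mean_value_rV n (f df : R -> 'rV[R]_n) (t K : R) : 0 <= t -> 0 <= K ->
  (forall s : R, 0 <= s <= t -> is_derive s 1 f (df s)) ->
  (forall s, 0 <= s <= t -> `|df s| <= K) -> `|f t - f 0| <= K * t.
Proof.
move=> t0 K0 Hf HK; apply: mx_norm_le => [|i j]; first exact: mulr_ge0.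
rewrite !mxE (ord1 i).
apply: (@mean_value_ge0 (fun s => f s 0 j) (fun s => df s 0 j)) => // s st.
  exact/is_derive_coord/Hf.
exact: le_trans (le_mx_norm _ _ _) (HK _ st).
Qed.

End OneVariable.

Section Staying.
Context {R : realType} (M : topologicalType) (n : nat).
Implicit Types (c : chart R M n) (X : 'rV[R]_n -> 'rV[R]_n).

Lemma open_dom_ball c (x0 : 'rV[R]_n) (e : R) :
  open [set q | dom c q /\ `|fwd c q - x0| < e].
Proof.
rewrite openE => q [cq qe].
have cf := fwd_continuous cq.
have oD : \forall r \near q, dom c r by exact: open_nbhs_nbhs (conj (dom_open c) cq).
apply: filterI => //=.
have : nbhs (fwd c q) [set y | `|y - x0| < e].
  have e' : 0 < e - `|fwd c q - x0| by rewrite subr_gt0.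
  apply: filterS (nbhsx_ballx (fwd c q) _ e') => y.
  rewrite -ball_normE /ball_ /= => yq.
  rewrite -[y](subrK (fwd c q)) -addrA; apply: le_lt_trans (ler_normD _ _) _.
  by rewrite -ltrBrDr distrC.
by move=> /cf.
Qed.

(** The set is the image under [bwd] of a compact ball, and compact sets of a Hausdorff space are
    closed. Closedness in all of M prevents a limit of points of the set from falling outside the
    chart domain. *)
Lemma closed_bwd_ball c (x0 : 'rV[R]_n) (e : R) : hausdorff_space M ->
  (forall x, `|x - x0| <= e -> img c x) ->
  closed [set q | dom c q /\ `|fwd c q - x0| <= e].
Proof.
move=> hM He.
have -> : [set q | dom c q /\ `|fwd c q - x0| <= e] =
    bwd c @` [set x | `|x - x0| <= e].
  apply/seteqP; split=> [q [cq qe]|_ [x xe <-]] /=.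
    by exists (fwd c q) => //; rewrite fwdK.
  by split; [exact/bwd_dom/He|rewrite bwdK //; exact: He].
apply: compact_closed => //; apply: continuous_compact.
  apply: continuous_in_subspaceT => x; rewrite inE /= => xe.
  exact/bwd_continuous/He.
apply: bounded_closed_compact.
  exists (`|x0| + e); split; first exact: num_real.
  move=> r rl x /= xe; apply: le_trans (ltW rl).
  by rewrite -[x](subrK x0) addrC; apply: le_trans (ler_normD _ _) _; rewrite lerD2l.
have := @closed_closed_ball_ R _ x0 e.
by congr (closed _); apply/seteqP; split=> x /=; rewrite distrC.
Qed.

(* At a first exit time T, the mean value inequality on [0, T[ keeps the curve *)
(* in a smaller closed ball, which is closed in M because M is Hausdorff.      *)
Lemma curve_stays_ge0 c (th : R -> M) X (x0 : 'rV[R]_n) (e K t : R) :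
  hausdorff_space M -> continuous th -> 0 <= K -> 0 <= t ->
  (forall x, `|x - x0| <= e -> img c x) ->
  (forall s : R, dom c (th s) ->
     is_derive s 1 (fwd c \o th) (X (fwd c (th s)))) ->
  (forall x, `|x - x0| <= e -> `|X x| <= K) ->
  dom c (th 0) -> `|fwd c (th 0) - x0| <= e / 2 -> K * t < e / 2 ->
  dom c (th t) /\ `|fwd c (th t) - x0| < e.
Proof.
move=> hM cth K0 t0 He dth HX c0 th0 Kt.
have e0 : 0 < e / 2 by apply: le_lt_trans Kt; exact: mulr_ge0.
pose N := [set q | dom c q /\ `|fwd c q - x0| < e].
have oN : open N by exact: open_dom_ball.
have N0 : N (th 0) by split=> //; lra.
apply: contrapT => Nt.
pose S := `[0, t]%classic `&` th @^-1` (~` N).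
have cS : compact S.
  apply: (@subclosed_compact _ _ `[0, t]%classic).
  - apply: closedI; first exact: interval_closed.
    by apply: preimage_closed => //; exact: open_closedC.
  - exact: segment_compact.
  - by move=> ? [].
have [//||T TS Tmin] := @compact_EVT_min R R id S _ cS.
- by exists t; split => //=; rewrite in_itv /= t0 lexx.
- by apply: continuous_subspaceT => x.
move: TS; rewrite inE => -[/=]; rewrite in_itv /= => /andP[T0 Tt] NT.
have Tgt0 : 0 < T.
  by rewrite lt_neqAle T0 andbT; apply/eqP => T00; apply: NT; rewrite -T00.
have inN s : 0 <= s -> s < T -> N (th s).
  move=> s0 sT; apply: contrapT => Ns.
  have : s \in S by rewrite inE; split => //=; rewrite in_itv /= s0 (le_trans (ltW sT)).
  by move=> /Tmin /=; rewrite leNgt sT.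
pose F := [set q | dom c q /\ `|fwd c q - x0| <= e / 2 + K * t].
have cF : closed F by apply: closed_bwd_ball => // x xe; apply: He; lra.
have inF s : 0 <= s -> s < T -> F (th s).
  move=> s0 sT; split; first by have [] := inN s s0 sT.
  have -> : fwd c (th s) - x0 =
    ((fwd c \o th) s - (fwd c \o th) 0) + (fwd c (th 0) - x0) by rewrite /= addrA subrK.
  apply: le_trans (ler_normD _ _) _; rewrite addrC lerD //.
  apply: (@le_trans _ _ (K * s)); last first.
    by rewrite ler_wpM2l // (le_trans (ltW sT)).
  apply: (@mean_value_rV _ _ _ (fun s => X (fwd c (th s)))) => // r /andP[r0 rs].
    by apply: dth; have [] := inN r r0 (le_lt_trans rs sT).
  by apply: HX; have [_ /ltW] := inN r r0 (le_lt_trans rs sT).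
have FT : F (th T).
  apply: (@closed_cvg _ _ (at_left T) _ th F cF).
    near=> s; apply: inF => //; near: s.
    exact: nbhs_left_ge.
  by apply: cvg_at_left_filter; exact: cth.
by apply: NT; case: FT => ? le; split=> //; apply: le_lt_trans le _; lra.
Unshelve. all: by end_near. Qed.

(** Negative times reduce to positive ones by reversing both the curve and the field. *)
Lemma curve_stays c (th : R -> M) X (x0 : 'rV[R]_n) (e K t : R) :
  hausdorff_space M -> continuous th -> 0 <= K ->
  (forall x, `|x - x0| <= e -> img c x) ->
  (forall s : R, dom c (th s) ->
     is_derive s 1 (fwd c \o th) (X (fwd c (th s)))) ->
  (forall x, `|x - x0| <= e -> `|X x| <= K) ->
  dom c (th 0) -> `|fwd c (th 0) - x0| <= e / 2 -> K * `|t| < e / 2 ->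
  dom c (th t) /\ `|fwd c (th t) - x0| < e.
Proof.
move=> hM cth K0 He dth HX c0 th0 Kt; have [t0|/ltW t0] := leP 0 t.
  apply: (@curve_stays_ge0 c th X x0 e K t) => //.
  by rewrite ger0_norm in Kt.
have := @curve_stays_ge0 c (fun s => th (- s)) (fun x => - X x) x0 e K (- t).
rewrite opprK oppr0; apply => //.
- by move=> s; apply: continuous_comp; [exact: opp_continuous|exact: cth].
- by rewrite oppr_ge0.
- by move=> s /dth; exact: (@is_derive_opp_arg _ _ (fwd c \o th)).
- by move=> x /HX; rewrite normrN.
- by rewrite ler0_norm in Kt.
Qed.

End Staying.

(** * Expansions along flows of the action *)

Section FundamentalFields.
Context {R : realType} (P : problem R).
Local Notation G := (grp P).
Local Notation M := (mfd P).
Local Notation c0 := (lg_chart G).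
Implicit Types (c : chart R M (mdim M)) (u : lieAlg G) (q : M).

Lemma gexp0 : gexp (0 : lieAlg G) = lg_one G.
Proof.
have [_ /(_ 0 0) H _] := gexpP (0 : lieAlg G).
rewrite !scaler0 in H.
have := congr1 (fun g => lg_mul (lg_inv (gexp (0 : lieAlg G))) g) H.
by rewrite lg_mulA !lg_mulV lg_mul1.
Qed.

Lemma act_one q : act (lg_one G) q = q.
Proof. by have [H _ _] := actP P; exact: H. Qed.

Lemma act_mul g k q : act (lg_mul g k) q = act g (act k q).
Proof. by have [_ H _] := actP P; exact: H. Qed.

Lemma act_gexpD s t u q :
  act (gexp ((s + t) *: u)) q = act (gexp (s *: u)) (act (gexp (t *: u)) q).
Proof. by have [_ /(_ s t) -> _] := gexpP u; rewrite act_mul. Qed.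

Lemma gexp_curve_continuous u : continuous (fun t : R => gexp (t *: u)).
Proof. by have [[]] := gexpP u. Qed.

Lemma flow_continuous u q : continuous (fun t : R => act (gexp (t *: u)) q).
Proof.
have [_ _ [cact _]] := actP P => t.
have cp : {for t, continuous (fun t : R => (gexp (t *: u), q))}.
  by apply: cvg_pair => /=; [exact: gexp_curve_continuous|exact: cvg_cst].
exact: (continuous_comp cp (cact (gexp (t *: u), q))).
Qed.

Definition act_chart c (z : 'rV[R]_(mdim G) * 'rV[R]_(mdim M)) :=
  fwd c (act (bwd c0 z.1) (bwd c z.2)).

(* The vector field lambda_*(u), read in the chart [c]: see [inf_actionE]. *)
Definition fund c u (x : 'rV[R]_(mdim M)) : 'rV[R]_(mdim M) :=
  'd (act_chart c) (fwd c0 (lg_one G), x) ((u : 'rV[R]_(mdim G)), 0).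

Let dom_act c := (img c0 `*` img c) `&`
  [set z | dom c (act (bwd c0 z.1) (bwd c z.2))].

Lemma dom_act_one c x : img c x -> dom_act c (fwd c0 (lg_one G), x).
Proof.
move=> cx; split; first by split => //=; exact/fwd_img/lg_chart_one.
by rewrite /= fwdK ?act_one; [exact: bwd_dom|exact: lg_chart_one].
Qed.

Lemma act_chart_smooth c : atlas c -> smooth_on (dom_act c) (act_chart c).
Proof.
move=> ac; have [_ _ [_ /(_ c0 c c)]] := actP P.
by apply=> //; exact: lg_chart_atlas.
Qed.

Lemma act_chart_differentiable c x : atlas c -> img c x ->
  differentiable (act_chart c) (fwd c0 (lg_one G), x).
Proof.
by move=> ac cx; apply: smooth_on_differentiable (act_chart_smooth ac) _; exact: dom_act_one.
Qed.

Lemma fundE c u x : fund c u x = \sum_i u 0 i *: fund c (delta_mx 0 i) x.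
Proof.
have : (u : 'rV[R]_(mdim G), 0 : 'rV[R]_(mdim M)) =
    \sum_i (u : 'rV[R]_(mdim G)) 0 i *: (delta_mx 0 i, 0).
  rewrite {1}(row_sum_delta u).
  elim/big_rec2: _ => // i y1 y2 _ <-.
  by apply/eqP; rewrite xpair_eqE /= scaler0 addr0 !eqxx.
rewrite /fund => ->; rewrite linear_sum; apply: eq_bigr => i _.
by rewrite linearZ.
Qed.

Lemma smooth_fund c u j : atlas c ->
  smooth_on (img c) (fun x => fund c u x 0 j).
Proof.
move=> ac; apply: smooth_on_coord; first exact: img_open.
move=> k; apply: (Ck_on_slice (E := dom_act c)
  (f := fun z => 'd (act_chart c) z ((u : 'rV[R]_(mdim G)), 0))).
- exact: img_open.
- by move=> x; exact: dom_act_one.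
- exact/smooth_on_diff/act_chart_smooth.
Qed.

(** Chain rule for [act_chart] along t |-> (exp(tu), q), whose first component has velocity [u] at
    the identity. For small t the exponential stays in the chart around the identity, so reading it
    there loses nothing. *)
Lemma fund_is_derive0 c u q : atlas c -> dom c q ->
  is_derive (0 : R) 1 (fun t => fwd c (act (gexp (t *: u)) q)) (fund c u (fwd c q)).
Proof.
move=> ac cq; have [_ _ dE] := gexpP u.
have E0 : gexp ((0 : R) *: u) = lg_one G by rewrite scale0r gexp0.
have dpr : is_derive (0 : R) 1 (fun t : R => (fwd c0 (gexp (t *: u)), fwd c q))
    ((u : 'rV[R]_(mdim G)), 0).
  have [d1 e1] := diff1 dE.
  have d2 : differentiable (cst (fwd c q) : R -> _) (0 : R) by exact: differentiable_cst.
  have dp := differentiable_pair d1 d2.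
  apply: DeriveDef; first exact/derivable1_diffP.
  rewrite (deriveE (1 : R) dp) (diff_pair d1 d2) /=.
  by rewrite e1 (congr1 (fun h => h (1 : R)) (diff_cst (fwd c q) (0 : R))).
have := is_derive_comp (F := act_chart c) _ dpr.
rewrite E0 => /(_ (act_chart_differentiable ac (fwd_img cq))).
apply: near_eq_is_derive.
have : \forall t \near (0 : R), dom c0 (gexp (t *: u)).
  have := @gexp_curve_continuous u 0 (dom c0); apply.
  rewrite /= E0; apply: open_nbhs_nbhs; split; first exact: dom_open.
  exact: lg_chart_one.
by apply: filterS => t ct; rewrite /act_chart /= !fwdK.
Qed.

Lemma inf_actionE c u q : atlas c -> dom c q ->
  inf_action c u q = fund c u (fwd c q).
Proof.
move=> ac cq; rewrite /inf_action derive1E.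
by have /@derive_val := fund_is_derive0 u ac cq.
Qed.

Lemma flow_is_derive c u q (t : R) : atlas c -> dom c (act (gexp (t *: u)) q) ->
  is_derive t 1 (fun s => fwd c (act (gexp (s *: u)) q))
    (fund c u (fwd c (act (gexp (t *: u)) q))).
Proof.
move=> ac cq; have := fund_is_derive0 u ac cq.
set f := (X in is_derive _ _ X _) => /diff1[df fl].
have sh : is_derive t 1 (fun s : R => s - t) 1 by exact: is_derive_shift.
have := is_derive_comp (f := fun s : R => s - t) (F := f) (s := t).
rewrite subrr => /(_ _ df sh); rewrite fl.
by apply: near_eq_is_derive; near=> s; rewrite /f /= -act_gexpD subrK.
Unshelve. all: by end_near. Qed.

End FundamentalFields.

(** * Landau estimates as the step size tends to 0 *)

Section BigOh.
Context {R : realType}.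
Implicit Types W : normedModType R.

Definition Oh W (k : nat) (a : R -> W) :=
  exists C, \forall h \near (0 : R), `|a h| <= C * `|h| ^+ k.

Lemma Oh_ge0 W k (a : R -> W) : Oh k a ->
  exists2 C, 0 <= C & \forall h \near (0 : R), `|a h| <= C * `|h| ^+ k.
Proof.
move=> [C HC]; exists `|C| => //; apply: filterS HC => h /le_trans; apply.
by rewrite ler_wpM2r ?exprn_ge0 // ler_norm.
Qed.

Lemma Oh_near W k (a b : R -> W) : (\forall h \near (0 : R), a h = b h) ->
  Oh k a -> Oh k b.
Proof.
by move=> ab [C HC]; exists C; apply: filterS2 ab HC => h ->.
Qed.

Lemma OhD W k (a b : R -> W) : Oh k a -> Oh k b -> Oh k (fun h => a h + b h).
Proof.
move=> [C HC] [D HD]; exists (C + D); apply: filterS2 HC HD => h HC HD.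
by rewrite mulrDl (le_trans (ler_normD _ _)) // lerD.
Qed.

Lemma OhN W k (a : R -> W) : Oh k a -> Oh k (fun h => - a h).
Proof. by move=> [C HC]; exists C; apply: filterS HC => h; rewrite normrN. Qed.

Lemma OhZ W j k (a : R -> R) (b : R -> W) :
  Oh j a -> Oh k b -> Oh (j + k) (fun h => a h *: b h).
Proof.
move=> /Oh_ge0[C C0 HC] [D HD]; exists (C * D).
apply: filterS2 HC HD => h HC HD.
by rewrite normrZ exprD mulrACA ler_pM.
Qed.

Lemma OhM j k (a b : R -> R) :
  Oh j a -> Oh k b -> Oh (j + k) (fun h => a h * b h).
Proof. exact: OhZ. Qed.

Lemma Oh_cst W (w : W) : Oh 0 (fun=> w).
Proof. by exists `|w|; near=> h; rewrite expr0 mulr1. Unshelve. all: by end_near. Qed.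

Lemma Oh_X k : Oh k (fun h : R => h ^+ k).
Proof.
by exists 1; near=> h; rewrite mul1r normrX.
Unshelve. all: by end_near. Qed.

Lemma Oh_le W j k (a : R -> W) : (j <= k)%N -> Oh k a -> Oh j a.
Proof.
move=> jk /Oh_ge0[C C0 HC]; exists C.
have h1 : \forall h \near (0 : R), `|h| <= 1.
  by apply: filterS (nbhs0_lt ltr01) => h /ltW.
apply: filterS2 h1 HC => h h1 /le_trans; apply.
by rewrite ler_wpM2l // ler_wiXn2l.
Qed.

Lemma Oh_sum W k I (r : seq I) (a : I -> R -> W) :
  (forall i, Oh k (a i)) -> Oh k (fun h => \sum_(i <- r) a i h).
Proof.
move=> Ha; elim: r => [|i r IH].
  exists 0; near=> h; by rewrite big_nil normr0 mul0r.
by apply: Oh_near (OhD (Ha i) IH); near=> h; rewrite big_cons.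
Unshelve. all: by end_near. Qed.

Lemma Oh_rV n k (a : R -> 'rV[R]_n) :
  (forall j, Oh k (fun h => a h 0 j)) -> Oh k a.
Proof.
move=> Ha; have : Oh k (fun h => \sum_j a h 0 j *: delta_mx 0 j : 'rV[R]_n).
  apply: Oh_sum => j; rewrite -[k]addn0; apply: OhZ => //; exact: Oh_cst.
by apply: Oh_near; near=> h; rewrite -row_sum_delta.
Unshelve. all: by end_near. Qed.

Lemma Oh_coord n k (a : R -> 'rV[R]_n) j : Oh k a -> Oh k (fun h => a h 0 j).
Proof.
move=> [C HC]; exists C; apply: filterS HC => h; apply: le_trans.
exact: le_mx_norm.
Qed.

Lemma OhB W k (a b : R -> W) :
  Oh k a -> Oh k b -> Oh k (fun h => a h - b h).
Proof. by move=> Ha Hb; apply: OhD => //; exact: OhN. Qed.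

Lemma OhMr k (c : R) (a : R -> R) : Oh k a -> Oh k (fun h => c * a h).
Proof. by move=> Ha; apply: (@OhM 0 k) => //; exact: Oh_cst. Qed.

End BigOh.

(** * Taylor expansions uniform in the step size *)

Section Expansions.
Context {R : realType} (P : problem R).
Local Notation G := (grp P).
Local Notation M := (mfd P).
Variables (c : chart R M (mdim M)) (ac : atlas c) (x0 : 'rV[R]_(mdim M)).
Hypothesis cx0 : img c x0.
Implicit Types (u : R -> lieAlg G) (q : R -> M) (F : 'rV[R]_(mdim M) -> R).

Lemma near_norm_ball (Q : 'rV[R]_(mdim M) -> Prop) : (\forall x \near x0, Q x) ->
  exists2 e : R, 0 < e & forall x, `|x - x0| <= e -> Q x.
Proof.
move=> /nbhs_ballP[e /= e0 eQ]; exists (e / 2); first by rewrite divr_gt0.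
move=> x xe; apply: eQ; rewrite -ball_normE /ball_ /= distrC.
by apply: le_lt_trans xe _; rewrite gtr_pMr // invf_lt1 ?ltr1n.
Qed.

Lemma near_img : \forall x \near x0, img c x.
Proof. by apply: open_nbhs_nbhs; split; [exact: img_open|exact: cx0]. Qed.

Lemma smooth_loc_bound F : smooth_on (img c) F ->
  exists C : R, \forall x \near x0, `|F x| <= C.
Proof.
move=> sF; have cF := smooth_on_continuous sF cx0.
exists (`|F x0| + 1).
have H : \forall x \near x0, `|F x0 - F x| < 1 by move/cvgrPdist_lt : cF; exact.
apply: filterS H => x Fx; rewrite -[F x](subrK (F x0)) addrC.
by apply: le_trans (ler_normD _ _) _; rewrite lerD2l distrC ltW.
Qed.

(** [fund] is linear in the exponent, with finitely many locally bounded entries on the basis; so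
    one constant and one neighbourhood serve all exponents at once. *)
Lemma fund_loc_bound : exists2 C : R, 0 <= C &
  \forall x \near x0, forall v : lieAlg G, `|fund c v x| <= C * `|v|.
Proof.
have /choice[B HB] : forall ij : 'I_(mdim G) * 'I_(mdim M), exists C : R,
    \forall x \near x0, `|fund c (delta_mx 0 ij.1) x 0 ij.2| <= C.
  by move=> [i j]; apply: smooth_loc_bound; exact: smooth_fund.
pose S := \sum_ij `|B ij|.
have S0 : 0 <= S by apply: sumr_ge0.
exists ((mdim G)%:R * S); first by rewrite mulr_ge0.
have HA : \forall x \near x0,
    forall ij, `|fund c (delta_mx 0 ij.1) x 0 ij.2| <= B ij.
  exact: (@filter_forall _ _ (fun ij x =>
    is_true (`|fund c (delta_mx 0 ij.1) x 0 ij.2| <= B ij)) (nbhs x0) _ HB).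
apply: filterS HA => x Hx v; apply: mx_norm_le.
  by rewrite !mulr_ge0.
move=> i j; rewrite (ord1 i) fundE summxE.
apply: le_trans (ler_norm_sum _ _ _) _.
rewrite -mulrA -[X in X%:R * _]card_ord mulr_natl -sumr_const.
apply: ler_sum => k _; rewrite mxE normrM mulrC.
rewrite ler_pM //; last exact: le_mx_norm.
apply: le_trans (Hx (k, j)) _; rewrite /S (bigD1 (k, j)) //=.
by apply: le_trans (ler_norm _) _; rewrite lerDl sumr_ge0.
Qed.

Definition flow_at (v : lieAlg G) (t : R) (r : M) : M := act (gexp (t *: v)) r.

Lemma flow_at0 v r : flow_at v 0 r = r.
Proof. by rewrite /flow_at scale0r gexp0 act_one. Qed.

Definition tends q := (\forall h \near (0 : R), dom c (q h)) /\
  (fwd c (q h) @[h --> (0 : R)] --> x0).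

(** In the ball the speed is at most C K, so for small h a flow of duration at most |h| covers less
    than half the radius, and it starts in the inner half. *)
Lemma flow_stays u q (e : R) : Oh 0 u -> tends q -> 0 < e ->
  \forall h \near (0 : R), forall s : R, `|s| <= `|h| ->
    dom c (flow_at (u h) s (q h)) /\ `|fwd c (flow_at (u h) s (q h)) - x0| < e.
Proof.
move=> /Oh_ge0[K K0 HK] [cq qx0] e0.
have [C C0 HC] := fund_loc_bound.
have oD := near_img.
have := near_norm_ball (filterI HC oD) => -[d d0 Hd].
pose e1 := Num.min d e.
have e10 : 0 < e1 by rewrite lt_min d0 e0.
have e12 : 0 < e1 / 2 by rewrite divr_gt0.
have H1 : \forall h \near (0 : R), `|x0 - fwd c (q h)| < e1 / 2.
  by move/cvgrPdist_lt : qx0; exact.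
(* The added 1 keeps the divisor positive when C K = 0. *)
have H2 : \forall h \near (0 : R), `|h| < (e1 / 2) / (C * K + 1).
  by apply: nbhs0_lt; rewrite divr_gt0 // ltr_wpDl // mulr_ge0.
near=> h => s sh.
have [] // := @curve_stays R M (mdim M) c (fun s => flow_at (u h) s (q h))
  (fund c (u h)) x0 e1 (C * K) s (manifold_hausdorff (m := M)).
- exact: flow_continuous.
- exact: mulr_ge0.
- by move=> x; rewrite le_min => /andP[/Hd[]].
- by move=> r; exact: flow_is_derive.
- move=> x; rewrite le_min => /andP[/Hd[Hx _] _]; apply: le_trans (Hx _) _.
  rewrite ler_wpM2l //; near: h; apply: filterS HK => h.
  by rewrite expr0 mulr1.
- by rewrite flow_at0; near: h.
- rewrite flow_at0 distrC ltW //; near: h; exact: H1.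
- apply: le_lt_trans (_ : C * K * `|h| < _); first by rewrite ler_wpM2l // mulr_ge0.
  apply: le_lt_trans (_ : (C * K + 1) * `|h| < _); first by rewrite ler_wpM2r // lerDl.
  rewrite mulrC -ltr_pdivlMr; first by near: h; exact: H2.
  by rewrite ltr_wpDl // mulr_ge0.
by move=> dc fe; split => //; apply: lt_le_trans fe _; rewrite ge_min lexx orbT.
Unshelve. all: by end_near. Qed.

Lemma tends_flow u q : Oh 0 u -> tends q -> tends (fun h => flow_at (u h) h (q h)).
Proof.
move=> Hu Hq; split.
  have := flow_stays Hu Hq ltr01; apply: filterS => h /(_ h (lexx _)).
  by case.
apply/cvgrPdist_lt => e e0; have := flow_stays Hu Hq e0.
by apply: filterS => h /(_ h (lexx _))[_]; rewrite distrC.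
Qed.

Definition lie (v : lieAlg G) F x := 'd F x (fund c v x).

Lemma smooth_lie v F : smooth_on (img c) F -> smooth_on (img c) (lie v F).
Proof.
move=> sF; apply: smooth_on_diff_field => //; first exact: img_open.
by move=> j; exact: smooth_fund.
Qed.

Lemma lieE v F x : lie v F x = \sum_i v 0 i * lie (delta_mx 0 i) F x.
Proof.
rewrite /lie fundE linear_sum; apply: eq_bigr => i _.
by rewrite linearZ.
Qed.

(* The exponents of the scheme depend on the step size, so the remainders of  *)
(* its Taylor expansions must be bounded uniformly. The families below are    *)
(* finite sums of products of a bounded function of the step size and a       *)
(* smooth function of the point, hence locally bounded, and are closed under  *)
(* Lie derivatives along bounded exponents.                                   *)
Inductive bfam : (R -> 'rV[R]_(mdim M) -> R) -> Prop :=
| bfam_cst F : smooth_on (img c) F -> bfam (fun=> F)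
| bfam_add H K : bfam H -> bfam K -> bfam (fun h x => H h x + K h x)
| bfam_scale (a : R -> R) H : Oh 0 a -> bfam H -> bfam (fun h x => a h * H h x)
| bfam_ext H K : (forall h x, img c x -> H h x = K h x) -> bfam H -> bfam K.

Lemma bfam_sum I (r : seq I) (H : I -> R -> 'rV[R]_(mdim M) -> R) :
  (forall i, bfam (H i)) -> bfam (fun h x => \sum_(i <- r) H i h x).
Proof.
move=> HH; elim: r => [|i r IH].
  apply: (@bfam_ext (fun=> fun=> 0)); first by move=> h x _; rewrite big_nil.
  by apply: bfam_cst => k; exact: Ck_on_cst.
apply: bfam_ext (bfam_add (HH i) IH) => h x _; by rewrite big_cons.
Qed.

Lemma bfam_smooth H : bfam H -> forall h, smooth_on (img c) (H h).
Proof.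
have oD := @img_open _ _ _ c.
elim=> {H} [F sF h//|H K _ IH1 _ IH2 h k|a H _ _ IH h k|H K HK _ IH h k].
- by apply: Ck_onD => //; [exact: IH1|exact: IH2].
- by apply: Ck_onM => //; [exact: Ck_on_cst|exact: IH].
- by apply: Ck_on_ext (IH h k) => // x /HK.
Qed.

(** For a function that does not depend on h, the exponent is expanded in a basis of the Lie
    algebra, which moves the dependence on h into bounded scalar factors; linearity and locality of
    the differential give the other cases. *)
Lemma bfam_lie u H : Oh 0 u -> bfam H -> bfam (fun h => lie (u h) (H h)).
Proof.
move=> Hu; elim=> {H} [F sF|H K bH IH1 bK IH2|a H Ha bH IH|H K HK bH IH].
- apply: (@bfam_ext (fun h x => \sum_i u h 0 i * lie (delta_mx 0 i) F x)).
    by move=> h x _; rewrite [RHS]lieE.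
  apply: bfam_sum => i; apply: (@bfam_scale (fun h => u h 0 i) (fun=> lie (delta_mx 0 i) F)).
    exact: Oh_coord.
  by apply: bfam_cst; exact: smooth_lie.
- apply: bfam_ext (bfam_add IH1 IH2) => h x cx.
  have dH := smooth_on_differentiable (bfam_smooth bH h) cx.
  have dK := smooth_on_differentiable (bfam_smooth bK h) cx.
  by have /(congr1 (fun f => f (fund c (u h) x)))/esym := diffD dH dK.
- apply: bfam_ext (bfam_scale Ha IH) => h x cx.
  have dH := smooth_on_differentiable (bfam_smooth bH h) cx.
  by have /(congr1 (fun f => f (fund c (u h) x)))/esym := diffZ (a h) dH.
- apply: bfam_ext IH => h x cx; rewrite /lie.
  have nHK : \forall y \near x, H h y = K h y.
    by apply: (open_near (@img_open _ _ _ c) cx) => y; exact: HK.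
  have [_] := near_eq_diff nHK (smooth_on_differentiable (bfam_smooth bH h) cx).
  by move=> /(congr1 (fun f => f (fund c (u h) x)))/esym.
Qed.

Lemma bfam_lie_iter u H j : Oh 0 u -> bfam H ->
  bfam (fun h => iter j (lie (u h)) (H h)).
Proof.
move=> Hu bH; elim: j => [|j IH]; first exact: bH.
exact: (bfam_lie Hu IH).
Qed.

Lemma bfam_bound H : bfam H -> exists e C : R,
  0 < e /\ \forall h \near (0 : R), forall x, `|x - x0| < e -> `|H h x| <= C.
Proof.
elim=> {H} [F sF|H K bH [e1 [C1 [e10 IH1]]] bK [e2 [C2 [e20 IH2]]]
  |a H [A HA] bH [e [C [e0 IH]]]|H K HK bH [e [C [e0 IH]]]].
- have [C HC] := smooth_loc_bound sF; have [e e0 He] := near_norm_ball HC.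
  by exists e, C; split=> //; near=> h => x /ltW/He.
- exists (Num.min e1 e2), (C1 + C2); split; first by rewrite lt_min e10.
  apply: filterS2 IH1 IH2 => h H1 H2 x; rewrite lt_min => /andP[/H1 xe1 /H2 xe2].
  by apply: le_trans (ler_normD _ _) _; rewrite lerD.
- exists e, (A * C); split=> //; apply: filterS2 HA IH => h HA IH x /IH xe.
  by rewrite expr0 mulr1 in HA; rewrite normrM ler_pM.
- have oD := near_img.
  have [d d0 Hd] := near_norm_ball oD.
  exists (Num.min d e), C; split; first by rewrite lt_min d0.
  apply: filterS IH => h IH x; rewrite lt_min => /andP[/ltW xd /IH].
  by rewrite HK //; exact: Hd.
Unshelve. all: by end_near. Qed.

(** Time derivatives along the flow of [u h] are iterated Lie derivatives. [flow_stays] keeps the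
    whole flow segment inside the ball on which [bfam_bound] bounds the k-th one uniformly in h. *)
Lemma taylor_flow u q H k : Oh 0 u -> tends q -> bfam H ->
  Oh k (fun h => H h (fwd c (flow_at (u h) h (q h))) -
    taylor_poly k (fun j => iter j (lie (u h)) (H h) (fwd c (q h))) h).
Proof.
move=> Hu Hq bH.
have [e [C [e0 HC]]] := bfam_bound (bfam_lie_iter k Hu bH).
have := flow_stays Hu Hq e0.
exists C; apply: filterS2 HC (flow_stays Hu Hq e0) => h HC Hs.
pose g j s := iter j (lie (u h)) (H h) (fwd c (flow_at (u h) s (q h))).
have -> : (fun j => iter j (lie (u h)) (H h) (fwd c (q h))) = g ^~ 0.
  by apply/funext => j; rewrite /g flow_at0.
apply: (taylor_bound (g := g)) => [j s jk sh|s sh]; last first.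
  by apply: HC; have [] := Hs s sh.
have [cs _] := Hs s sh.
have := is_derive_comp (F := iter j (lie (u h)) (H h)) _ (flow_is_derive ac cs).
apply; apply: smooth_on_differentiable (fwd_img cs).
exact: bfam_smooth (bfam_lie_iter j Hu bH) h.
Qed.

Definition rhs_chart (x : 'rV[R]_(mdim M)) : lieAlg G := rhs (bwd c x).

Lemma smooth_rhs i : smooth_on (img c) (fun x => (rhs_chart x : 'rV[R]_(mdim G)) 0 i).
Proof.
apply: smooth_on_coord; first exact: img_open.
exact: rhs_smooth.
Qed.

Definition lie_rhs F x := lie (rhs_chart x) F x.

Lemma smooth_lie_rhs F : smooth_on (img c) F -> smooth_on (img c) (lie_rhs F).
Proof.
move=> sF k; have oD := @img_open _ _ _ c.
apply: (@Ck_on_ext _ _ _ _ _ (fun x =>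
  \sum_i (rhs_chart x : 'rV[R]_(mdim G)) 0 i * lie (delta_mx 0 i) F x)) => //.
  by move=> x _; rewrite /lie_rhs [RHS]lieE.
apply: Ck_on_sum => // i; apply: Ck_onM => //; first exact: smooth_rhs.
exact: smooth_lie.
Qed.

(** Along the exact solution each time derivative is a Lie derivative in the direction of f at the
    current point. Continuity of the solution at 0 provides the confinement. *)
Lemma taylor_exact (p : M) (y : R -> M) F k : dom c p -> fwd c p = x0 ->
  exact_solution p y -> smooth_on (img c) F ->
  Oh k (fun h => F (fwd c (y h)) -
    taylor_poly k (fun j => iter j lie_rhs F x0) h).
Proof.
move=> cp px0 [y0 Hy] sF.
have siter j : smooth_on (img c) (iter j lie_rhs F).
  by elim: j => //= j IH; exact: smooth_lie_rhs.
have [C HC] := smooth_loc_bound (siter k); have [e e0 He] := near_norm_ball HC.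
have [cy0 dy0] := nbhs_singleton Hy.
have near_y : \forall t \near (0 : R), dom c (y t) /\ `|fwd c (y t) - x0| < e.
  have := @open_dom_ball R M _ c x0 e => oN.
  apply: (cy0 [set r | dom c r /\ `|fwd c r - x0| < e]).
  by apply: open_nbhs_nbhs; split => //=; rewrite y0 px0 subrr normr0.
have [d /= d0 Hd] := filterI Hy near_y.
exists C; apply: filterS (nbhs0_lt d0) => h hd0.
have hd s : `|s| <= `|h| -> ball_ (fun x : R => `|x|) 0 d s.
  by move=> sh; rewrite /ball_ /= sub0r normrN; exact: le_lt_trans sh hd0.
pose g j s := iter j lie_rhs F (fwd c (y s)).
have -> : (fun j => iter j lie_rhs F x0) = g ^~ 0.
  by apply/funext => j; rewrite /g y0 px0.
apply: (taylor_bound (g := g)) => [j s jk /hd/Hd[[_ ys] [cs _]]|s /hd/Hd[_ [_ ys]]].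
  have := is_derive_comp (F := iter j lie_rhs F) _ (ys c ac cs).
  rewrite /g /= /lie_rhs /lie /rhs_chart fwdK // inf_actionE //; apply.
  exact: smooth_on_differentiable (siter j) (fwd_img cs).
by apply: He; exact: ltW.
Qed.

End Expansions.

(** * Multilinear forms in the exponents and expansions of the stages *)

Section Forms.
Context {R : realType} (m : nat).
Implicit Types (v w z : 'rV[R]_m).

(** Forms given by their values on the standard basis. With iterated Lie derivatives at a point as
    values, they describe those derivatives as functions of the exponents; the order of the
    arguments matters. *)
Definition form1 (e : 'I_m -> R) v := \sum_i v 0 i * e i.
Definition form2 (e : 'I_m -> 'I_m -> R) v w :=
  form1 (fun j => form1 (fun i => e i j) v) w.
Definition form3 (e : 'I_m -> 'I_m -> 'I_m -> R) v w z :=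
  form1 (fun k => form2 (fun i j => e i j k) v w) z.

Lemma form1D e v w : form1 e (v + w) = form1 e v + form1 e w.
Proof. by rewrite -big_split; apply: eq_bigr => i _; rewrite mxE mulrDl. Qed.

Lemma form1Z e a v : form1 e (a *: v) = a * form1 e v.
Proof. by rewrite mulr_sumr; apply: eq_bigr => i _; rewrite mxE mulrA. Qed.

Lemma form1B e v w : form1 e (v - w) = form1 e v - form1 e w.
Proof. by rewrite -[- w]scaleN1r form1D form1Z mulN1r. Qed.

Lemma form1Dl e1 e2 v :
  form1 (fun i => e1 i + e2 i) v = form1 e1 v + form1 e2 v.
Proof. by rewrite -big_split; apply: eq_bigr => i _; rewrite mulrDr. Qed.

Lemma form1Zl e a v : form1 (fun i => a * e i) v = a * form1 e v.
Proof. by rewrite mulr_sumr; apply: eq_bigr => i _; rewrite mulrCA. Qed.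

Lemma eq_form1 e1 e2 v : e1 =1 e2 -> form1 e1 v = form1 e2 v.
Proof. by move=> ee; apply: eq_bigr => i _; rewrite ee. Qed.

Lemma form2Dr e v w z : form2 e v (w + z) = form2 e v w + form2 e v z.
Proof. exact: form1D. Qed.

Lemma form2Zr e a v w : form2 e v (a *: w) = a * form2 e v w.
Proof. exact: form1Z. Qed.

Lemma form2Dl e v w z : form2 e (v + w) z = form2 e v z + form2 e w z.
Proof. by rewrite -form1Dl; apply: eq_form1 => j; rewrite form1D. Qed.

Lemma form2Zl e a v w : form2 e (a *: v) w = a * form2 e v w.
Proof. by rewrite -form1Zl; apply: eq_form1 => j; rewrite form1Z. Qed.

Lemma form3D3 e v w y z : form3 e v w (y + z) = form3 e v w y + form3 e v w z.
Proof. exact: form1D. Qed.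

Lemma form3Z3 e a v w z : form3 e v w (a *: z) = a * form3 e v w z.
Proof. exact: form1Z. Qed.

Lemma form3D2 e v w y z : form3 e v (w + y) z = form3 e v w z + form3 e v y z.
Proof. by rewrite -form1Dl; apply: eq_form1 => j; rewrite form2Dr. Qed.

Lemma form3Z2 e a v w z : form3 e v (a *: w) z = a * form3 e v w z.
Proof. by rewrite -form1Zl; apply: eq_form1 => j; rewrite form2Zr. Qed.

Lemma form3D1 e v w y z : form3 e (v + w) y z = form3 e v y z + form3 e w y z.
Proof. by rewrite -form1Dl; apply: eq_form1 => j; rewrite form2Dl. Qed.

Lemma form3Z1 e a v w z : form3 e (a *: v) w z = a * form3 e v w z.
Proof. by rewrite -form1Zl; apply: eq_form1 => j; rewrite form2Zl. Qed.

Lemma form1N e v : form1 e (- v) = - form1 e v.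
Proof. by rewrite -scaleN1r form1Z mulN1r. Qed.

Lemma form2Nr e v w : form2 e v (- w) = - form2 e v w.
Proof. exact: form1N. Qed.

Lemma form2Nl e v w : form2 e (- v) w = - form2 e v w.
Proof. by rewrite -scaleN1r form2Zl mulN1r. Qed.

Lemma form3N3 e v w z : form3 e v w (- z) = - form3 e v w z.
Proof. exact: form1N. Qed.

Lemma form3N2 e v w z : form3 e v (- w) z = - form3 e v w z.
Proof. by rewrite -scaleN1r form3Z2 mulN1r. Qed.

Lemma form3N1 e v w z : form3 e (- v) w z = - form3 e v w z.
Proof. by rewrite -scaleN1r form3Z1 mulN1r. Qed.

Lemma Oh_form1 j k (e : 'I_m -> R -> R) (v : R -> 'rV[R]_m) :
  (forall i, Oh j (e i)) -> Oh k v ->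
  Oh (j + k) (fun h => form1 (fun i => e i h) (v h)).
Proof.
move=> He Hv; apply: Oh_sum => i; rewrite addnC; apply: OhM => //.
exact: Oh_coord.
Qed.

Lemma Oh_form2 j k e (v w : R -> 'rV[R]_m) : Oh j v -> Oh k w ->
  Oh (j + k) (fun h => form2 e (v h) (w h)).
Proof.
move=> Hv Hw; apply: Oh_form1 => // i.
by rewrite -[j]add0n; apply: (Oh_form1 (e := fun l _ => e l i)) => // l; exact: Oh_cst.
Qed.

Lemma Oh_form3 i j k e (v w z : R -> 'rV[R]_m) : Oh i v -> Oh j w -> Oh k z ->
  Oh (i + j + k) (fun h => form3 e (v h) (w h) (z h)).
Proof. by move=> Hv Hw Hz; apply: Oh_form1 => // l; exact: Oh_form2. Qed.

Lemma OhXM k (j : nat) (a : R -> R) : Oh j a -> Oh (k + j) (fun h => h ^+ k * a h).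
Proof. by move=> Ha; apply: OhM => //; exact: Oh_X. Qed.

Variables (f0 d1 : 'rV[R]_m).

(** In the applications [f0] is f and [d1] is f'f, both at the starting point. Every stage and
    exponent has its first two terms on these fixed vectors, so only the scalars [s0] and [s1] need
    to be tracked. *)
Definition expands1 (s : R -> 'rV[R]_m) s0 := Oh 1 (fun h => s h - s0 *: f0).
Definition expands2 (s : R -> 'rV[R]_m) s0 s1 :=
  Oh 2 (fun h => s h - (s0 *: f0 + (h * s1) *: d1)).
Definition expands3 (s : R -> 'rV[R]_m) s0 s1 r :=
  Oh 3 (fun h => s h - (s0 *: f0 + (h * s1) *: d1 + h ^+ 2 *: r)).

Lemma OhXZ k (w : 'rV[R]_m) : Oh k (fun h : R => h ^+ k *: w).
Proof.
by rewrite -[k]addn0; apply: OhZ; [rewrite addn0; exact: Oh_X|exact: Oh_cst].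
Qed.

Lemma expands32 s s0 s1 r : expands3 s s0 s1 r -> expands2 s s0 s1.
Proof.
move=> /(Oh_le (isT : 2 <= 3)%N) Hs; apply: Oh_near (OhD Hs (OhXZ 2 r)).
by near=> h; rewrite opprD addrA subrK.
Unshelve. all: by end_near. Qed.

Lemma expands21 s s0 s1 : expands2 s s0 s1 -> expands1 s s0.
Proof.
move=> /(Oh_le (isT : 1 <= 2)%N) Hs; apply: Oh_near (OhD Hs (OhXZ 1 (s1 *: d1))).
by near=> h; rewrite opprD addrA expr1 scalerA subrK.
Unshelve. all: by end_near. Qed.

Lemma expands10 s s0 : expands1 s s0 -> Oh 0 s.
Proof.
move=> /(Oh_le (isT : 0 <= 1)%N) Hs; apply: Oh_near (OhD Hs (Oh_cst (s0 *: f0))).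
by near=> h; rewrite subrK.
Unshelve. all: by end_near. Qed.

Lemma form1_ex3 e s s0 s1 r : expands3 s s0 s1 r ->
  Oh 3 (fun h => form1 e (s h) -
    (s0 * form1 e f0 + h * s1 * form1 e d1 + h ^+ 2 * form1 e r)).
Proof.
move=> Hs; have := Oh_form1 (j := 0) (fun i => Oh_cst (e i)) Hs.
apply: Oh_near; near=> h; by rewrite form1B !form1D !form1Z.
Unshelve. all: by end_near. Qed.

Lemma form1_ex2 e s s0 s1 : expands2 s s0 s1 ->
  Oh 2 (fun h => form1 e (s h) - (s0 * form1 e f0 + h * s1 * form1 e d1)).
Proof.
move=> Hs; have := Oh_form1 (j := 0) (fun i => Oh_cst (e i)) Hs.
apply: Oh_near; near=> h; by rewrite form1B !form1D !form1Z.
Unshelve. all: by end_near. Qed.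

Lemma form1_ex1 e s s0 : expands1 s s0 ->
  Oh 1 (fun h => form1 e (s h) - s0 * form1 e f0).
Proof.
move=> Hs; have := Oh_form1 (j := 0) (fun i => Oh_cst (e i)) Hs.
apply: Oh_near; near=> h; by rewrite form1B !form1Z.
Unshelve. all: by end_near. Qed.

Lemma form2_ex2 e s s0 s1 t t0 t1 : expands2 s s0 s1 -> expands2 t t0 t1 ->
  Oh 2 (fun h => form2 e (s h) (t h) - (s0 * t0 * form2 e f0 f0 +
    h * (s0 * t1 * form2 e f0 d1 + s1 * t0 * form2 e d1 f0))).
Proof.
move=> Hs Ht; have ht := expands10 (expands21 Ht).
have hp : Oh 0 (fun h : R => s0 *: f0 + (h * s1) *: d1).
  apply: Oh_near (OhD (expands10 (expands21 Hs)) (OhN (Oh_le (isT : 0 <= 2)%N Hs))).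
  by near=> h; rewrite opprB addrC subrK.
have H1 := Oh_form2 e Hs ht.
have H2 := Oh_form2 e hp Ht.
(* The product of the two terms in h is missing from the claimed expansion and is of order h^2. *)
have H3 : Oh 2 (fun h => h ^+ 2 * (s1 * t1 * form2 e d1 d1)).
  by apply: (@OhXM 2 0); exact: Oh_cst.
apply: Oh_near (OhD (OhD H1 H2) H3); near=> h.
rewrite !(form2Nl, form2Nr, form2Dl, form2Dr, form2Zl, form2Zr).
ring.
Unshelve. all: by end_near. Qed.

Lemma form2_ex1 e s s0 t t0 : expands1 s s0 -> expands1 t t0 ->
  Oh 1 (fun h => form2 e (s h) (t h) - s0 * t0 * form2 e f0 f0).
Proof.
move=> Hs Ht; have ht := expands10 Ht.
have H1 := Oh_form2 e Hs ht.
have H2 := Oh_form2 e (Oh_cst (s0 *: f0)) Ht.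
apply: Oh_near (OhD H1 H2); near=> h.
rewrite !(form2Nl, form2Nr, form2Dl, form2Dr, form2Zl, form2Zr).
ring.
Unshelve. all: by end_near. Qed.

Lemma form3_ex1 e s s0 t t0 u u0 : expands1 s s0 -> expands1 t t0 -> expands1 u u0 ->
  Oh 1 (fun h => form3 e (s h) (t h) (u h) - s0 * t0 * u0 * form3 e f0 f0 f0).
Proof.
move=> Hs Ht Hu.
have H1 := Oh_form3 e Hs (expands10 Ht) (expands10 Hu).
have H2 := Oh_form3 e (Oh_cst (s0 *: f0)) Ht (expands10 Hu).
have H3 := Oh_form3 e (Oh_cst (s0 *: f0)) (Oh_cst (t0 *: f0)) Hu.
apply: Oh_near (OhD (OhD H1 H2) H3); near=> h.
rewrite !(form3N1, form3N2, form3N3, form3D1, form3D2, form3D3, form3Z1, form3Z2, form3Z3).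
ring.
Unshelve. all: by end_near. Qed.

End Forms.

Lemma taylor_poly2 {R : realType} a (h : R) : taylor_poly 2 a h = a 0%N + h * a 1%N.
Proof.
by rewrite /taylor_poly !big_ord_recr big_ord0 /= !factS fact0 expr0 expr1; field.
Qed.

Lemma taylor_poly1 {R : realType} a (h : R) : taylor_poly 1 a h = a 0%N.
Proof. by rewrite /taylor_poly big_ord1 fact0 expr0 divr1 mul1r. Qed.

Lemma taylor_poly3 {R : realType} a (h : R) :
  taylor_poly 3 a h = a 0%N + h * a 1%N + h ^+ 2 / 2 * a 2%N.
Proof.
rewrite /taylor_poly !big_ord_recr big_ord0 /= !factS fact0 expr0 expr1; by field.
Qed.

Lemma taylor_poly4 {R : realType} a (h : R) : taylor_poly 4 a h =
  a 0%N + h * a 1%N + h ^+ 2 / 2 * a 2%N + h ^+ 3 / 6 * a 3%N.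
Proof.
rewrite /taylor_poly !big_ord_recr big_ord0 /= !factS fact0 expr0 expr1; by field.
Qed.

(** * Iterated Lie derivatives as forms *)

Section LieCalculus.
Context {R : realType} (P : problem R).
Local Notation G := (grp P).
Local Notation M := (mfd P).
Variables (c : chart R M (mdim M)) (ac : atlas c).
Implicit Types (F : 'rV[R]_(mdim M) -> R) (v w z : lieAlg G).
Local Notation S := (smooth_on (img c)).
Local Notation L := (lie c).
Local Notation E i := (lie (P := P) c (delta_mx 0 i)).

Let oD : open (img c) := @img_open _ _ _ c.

Lemma lie_form1 v F x : L v F x = form1 (fun i => E i F x) v.
Proof. exact: lieE. Qed.

Lemma lie_ext v F H x : S F -> img c x -> (forall x, img c x -> F x = H x) ->
  L v F x = L v H x.
Proof.
move=> sF cx FH.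
have nFH : \forall y \near x, F y = H y by exact: (open_near oD cx).
have [_] := near_eq_diff nFH (smooth_on_differentiable sF cx).
by move=> /(congr1 (fun f => f (fund c v x)))/esym.
Qed.

Lemma smooth_sumM I (r : seq I) (a b : I -> 'rV[R]_(mdim M) -> R) :
  (forall i, S (a i)) -> (forall i, S (b i)) ->
  S (fun x => \sum_(i <- r) a i x * b i x).
Proof.
move=> sa sb k; apply: Ck_on_sum => // i.
by apply: Ck_onM => //; [exact: sa|exact: sb].
Qed.

Lemma lie_sumM I (r : seq I) (a b : I -> 'rV[R]_(mdim M) -> R) v x : img c x ->
  (forall i, S (a i)) -> (forall i, S (b i)) ->
  L v (fun x => \sum_(i <- r) a i x * b i x) x =
  \sum_(i <- r) (L v (a i) x * b i x + a i x * L v (b i) x).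
Proof.
move=> cx sa sb; elim: r => [|i r IH].
  rewrite big_nil; have -> : (fun x => \sum_(i <- [::]) a i x * b i x) = cst 0.
    by apply/funext => y; rewrite big_nil.
  exact: (congr1 (fun f => f (fund c v x)) (diff_cst (0 : R) x)).
have da := smooth_on_differentiable (sa i) cx.
have db := smooth_on_differentiable (sb i) cx.
have ds := smooth_on_differentiable (smooth_sumM r sa sb) cx.
rewrite big_cons -IH.
have -> : (fun x => \sum_(i <- i :: r) a i x * b i x) =
    a i * b i + (fun x => \sum_(i <- r) a i x * b i x).
  by apply/funext => y; rewrite big_cons.
have /(congr1 (fun f => f (fund c v x))) := diffD (differentiableM da db) ds.
rewrite /= => e; rewrite /lie [LHS]e; congr (_ + _).
apply: etrans (congr1 (fun f => f (fund c v x)) (diffM da db)) _.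
rewrite -[LHS]/(a i x * L v (b i) x + b i x * L v (a i) x).
by rewrite addrC [b i x * _]mulrC.
Qed.

Lemma lie_form1_cst (b : 'I_(mdim G) -> 'rV[R]_(mdim M) -> R) v w x : img c x ->
  (forall i, S (b i)) ->
  L v (fun x => form1 (fun i => b i x) w) x = form1 (fun i => L v (b i) x) w.
Proof.
move=> cx sb; rewrite /form1.
have sw i : S (cst (w 0 i)) by move=> k; exact: Ck_on_cst.
apply: etrans (@lie_sumM _ _ (fun i => cst (w 0 i)) b v x cx sw sb) _.
apply: eq_bigr => i _.
have -> : L v (cst (w 0 i)) x = 0.
  exact: (congr1 (fun f => f (fund c v x)) (diff_cst (w 0 i) x)).
by rewrite mul0r add0r.
Qed.

Let sE F i : S F -> S (E i F). Proof. exact: smooth_lie. Qed.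

Lemma lie2_form1 v w F x : S F -> img c x ->
  L v (L w F) x = form1 (fun j => L v (E j F) x) w.
Proof.
move=> sF cx; apply: etrans (@lie_form1_cst _ v w x cx (fun j => sE j sF)).
by congr (L v _ x); apply/funext => y; exact: lie_form1.
Qed.

Lemma lie2_form2 v w F x : S F -> img c x ->
  L v (L w F) x = form2 (fun i j => E i (E j F) x) v w.
Proof.
move=> sF cx; apply: etrans (lie2_form1 v w sF cx) _.
by apply: eq_form1 => j; exact: lie_form1.
Qed.

Lemma lie3_form3 v w z F x : S F -> img c x ->
  L v (L w (L z F)) x = form3 (fun i j k => E i (E j (E k F)) x) v w z.
Proof.
move=> sF cx.
have sL : S (L w (L z F)) by exact: (smooth_lie ac w (smooth_lie ac z sF)).
have sLE k : S (L w (E k F)) by exact: (smooth_lie ac w (sE k sF)).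
apply: etrans (lie_ext v sL cx (fun y cy => lie2_form1 w z sF cy)) _.
apply: etrans (@lie_form1_cst _ v z x cx sLE) _.
by apply: eq_form1 => k; exact: (lie2_form2 v w (sE k sF) cx).
Qed.

Local Notation f i := (fun x => (rhs_chart c x : 'rV[R]_(mdim G)) 0 i).
Local Notation fx x := (rhs_chart (P := P) c x).
Local Notation LF := (lie_rhs (P := P) c).

Let sf i : S (f i). Proof. exact: smooth_rhs. Qed.

Lemma lie_rhsE F x : LF F x = \sum_i f i x * E i F x.
Proof. exact: lieE. Qed.

Lemma lie_rhs2 F x : S F -> img c x ->
  LF (LF F) x = form1 (fun i => E i F x) (\row_i LF (f i) x) +
    form2 (fun i j => E i (E j F) x) (fx x) (fx x).
Proof.
move=> sF cx.
have -> : LF (LF F) x = L (fx x) (fun y => \sum_i f i y * E i F y) x.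
  by congr (L (fx x) _ x); apply/funext => y; exact: lie_rhsE.
apply: etrans (@lie_sumM _ _ _ _ (fx x) x cx sf (fun j => sE j sF)) _.
rewrite big_split; congr (_ + _).
  by apply: eq_bigr => i _; rewrite mxE.
by apply: eq_bigr => i _; congr (_ * _); exact: lie_form1.
Qed.

(** The direction f varies with the point, so each further derivative applies the product rule. The
    form in (f, f'f) arises twice, from [G1] and from [G2], but the form in (f'f, f) only once; this
    asymmetry is the source of the noncommutative order condition. *)
Lemma lie_rhs3 F x : S F -> img c x ->
  LF (LF (LF F)) x = form1 (fun i => E i F x) (\row_i LF (LF (f i)) x) +
    (2 * form2 (fun i j => E i (E j F) x) (fx x) (\row_i LF (f i) x) +
    form2 (fun i j => E i (E j F) x) (\row_i LF (f i) x) (fx x) +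
    form3 (fun i j k => E i (E j (E k F)) x) (fx x) (fx x) (fx x)).
Proof.
move=> sF cx.
have sEE i j : S (E i (E j F)) by exact: (sE i (sE j sF)).
have sLf i : S (LF (f i)) by exact: (smooth_lie_rhs ac (sf i)).
pose G1 y := \sum_i LF (f i) y * E i F y.
pose G3 j y := \sum_i f i y * E i (E j F) y.
pose G2 y := \sum_j f j y * G3 j y.
have sG1 : S G1 by exact: (smooth_sumM _ sLf (fun j => sE j sF)).
have sG3 j : S (G3 j) by exact: (smooth_sumM _ sf (fun i => sEE i j)).
have sG2 : S G2 by exact: (smooth_sumM _ sf sG3).
have sLL : S (LF (LF F)) by exact: (smooth_lie_rhs ac (smooth_lie_rhs ac sF)).
have LG : LF (LF (LF F)) x = L (fx x) G1 x + L (fx x) G2 x.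
  have HG y : img c y -> LF (LF F) y = (G1 + G2) y.
    move=> cy; apply: etrans (lie_rhs2 sF cy) _; rewrite -[RHS]/(G1 y + G2 y).
    by congr (_ + _); apply: eq_bigr => i _; rewrite mxE.
  apply: etrans (lie_ext (fx x) sLL cx HG) _.
  have := diffD (smooth_on_differentiable sG1 cx) (smooth_on_differentiable sG2 cx).
  by move=> /(congr1 (fun g => g (fund c (fx x) x))).
have eG1 : L (fx x) G1 x =
    form1 (fun i => E i F x) (\row_i LF (LF (f i)) x) +
    form2 (fun i j => E i (E j F) x) (fx x) (\row_i LF (f i) x).
  apply: etrans (@lie_sumM _ _ _ _ (fx x) x cx sLf (fun j => sE j sF)) _.
  rewrite big_split; congr (_ + _); first by apply: eq_bigr => i _; rewrite mxE.
  by apply: eq_bigr => i _; rewrite mxE; congr (_ * _); exact: lie_form1.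
have eG3 j : L (fx x) (G3 j) x =
    form1 (fun i => E i (E j F) x) (\row_i LF (f i) x) +
    form2 (fun i k => E i (E k (E j F)) x) (fx x) (fx x).
  apply: etrans (@lie_sumM _ _ _ _ (fx x) x cx sf (fun i => sEE i j)) _.
  rewrite big_split; congr (_ + _); first by apply: eq_bigr => i _; rewrite mxE.
  by apply: eq_bigr => i _; congr (_ * _); exact: lie_form1.
have eG2 : L (fx x) G2 x =
    form2 (fun i j => E i (E j F) x) (fx x) (\row_i LF (f i) x) +
    (form2 (fun i j => E i (E j F) x) (\row_i LF (f i) x) (fx x) +
    form3 (fun i j k => E i (E j (E k F)) x) (fx x) (fx x) (fx x)).
  apply: etrans (@lie_sumM _ _ _ _ (fx x) x cx sf sG3) _.
  rewrite big_split; congr (_ + _); first by apply: eq_bigr => i _; rewrite mxE.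
  rewrite -big_split; apply: eq_bigr => i _.
  by rewrite -[RHS]mulrDr; congr (_ * _); exact: eG3.
rewrite LG eG1 eG2; ring.
Qed.

End LieCalculus.

Section ExpansionCombinations.
Context {R : realType} (m : nat) (f0 d1 : 'rV[R]_m).
Local Notation expands2 := (expands2 f0 d1).
Local Notation expands3 := (expands3 f0 d1).

Lemma expands3Z a s s0 s1 r : expands3 s s0 s1 r ->
  expands3 (fun h => a *: s h) (a * s0) (a * s1) (a *: r).
Proof.
move=> Hs; apply: Oh_near (OhZ (Oh_cst a) Hs); near=> h.
by apply/rowP => i; rewrite !mxE; ring.
Unshelve. all: by end_near. Qed.

Lemma expands3D s s0 s1 r t t0 t1 q : expands3 s s0 s1 r -> expands3 t t0 t1 q ->
  expands3 (fun h => s h + t h) (s0 + t0) (s1 + t1) (r + q).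
Proof.
move=> Hs Ht; apply: Oh_near (OhD Hs Ht); near=> h.
by apply/rowP => i; rewrite !mxE; ring.
Unshelve. all: by end_near. Qed.

Lemma expands2Z a s s0 s1 : expands2 s s0 s1 -> expands2 (fun h => a *: s h) (a * s0) (a * s1).
Proof.
move=> Hs; apply: Oh_near (OhZ (Oh_cst a) Hs); near=> h.
by apply/rowP => i; rewrite !mxE; ring.
Unshelve. all: by end_near. Qed.

Lemma expands2D s s0 s1 t t0 t1 : expands2 s s0 s1 -> expands2 t t0 t1 ->
  expands2 (fun h => s h + t h) (s0 + t0) (s1 + t1).
Proof.
move=> Hs Ht; apply: Oh_near (OhD Hs Ht); near=> h.
by apply/rowP => i; rewrite !mxE; ring.
Unshelve. all: by end_near. Qed.

Lemma expands3_f0 : expands3 (fun=> f0) 1 0 0.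
Proof.
exists 0; near=> h.
by rewrite scale1r mulr0 scale0r scaler0 !addr0 subrr normr0 mul0r.
Unshelve. all: by end_near. Qed.

End ExpansionCombinations.

(** * Expansions at the starting point *)

Section LocalExpansions.
Context {R : realType} (P : problem R).
Local Notation G := (grp P).
Local Notation M := (mfd P).
Variables (c : chart R M (mdim M)) (ac : atlas c) (p : M) (cp : dom c p).
Implicit Types (F : 'rV[R]_(mdim M) -> R).
Local Notation S := (smooth_on (img c)).
Local Notation L := (lie c).
Local Notation E i := (lie (P := P) c (delta_mx 0 i)).
Local Notation x0 := (fwd c p).
Local Notation f i := (fun x => (rhs_chart c x : 'rV[R]_(mdim G)) 0 i).
Local Notation LF := (lie_rhs (P := P) c).

Let cx0 : img c x0. Proof. exact: fwd_img. Qed.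
Let sf i : S (f i). Proof. exact: smooth_rhs. Qed.

(* Lie derivatives at [p], and the elementary differentials f, f'f, f''(f,f)   *)
(* and f'f'f at [p].                                                           *)
Definition coef1 F i := E i F x0.
Definition coef2 F i j := E i (E j F) x0.
Definition coef3 F i j k := E i (E j (E k F)) x0.
Definition el_f : 'rV[R]_(mdim G) := rhs_chart c x0.
Definition el_f'f : 'rV[R]_(mdim G) := \row_i form1 (coef1 (f i)) el_f.
Definition el_f''ff : 'rV[R]_(mdim G) := \row_i form2 (coef2 (f i)) el_f el_f.
Definition el_f'f'f : 'rV[R]_(mdim G) := \row_i form1 (coef1 (f i)) el_f'f.

Lemma el_fE : el_f = rhs p.
Proof. by rewrite /el_f /rhs_chart fwdK. Qed.

Lemma lie1E F u : L u F x0 = form1 (coef1 F) u.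
Proof. exact: lie_form1. Qed.

Lemma lie2E F u v : S F -> L u (L v F) x0 = form2 (coef2 F) u v.
Proof. by move=> sF; exact: lie2_form2. Qed.

Lemma lie3E F u v w : S F -> L u (L v (L w F)) x0 = form3 (coef3 F) u v w.
Proof. by move=> sF; exact: lie3_form3. Qed.

Lemma lie_rhs1E F : LF F x0 = form1 (coef1 F) el_f.
Proof. exact: lie_form1. Qed.

Lemma row_lie_rhs1 : \row_i LF (f i) x0 = el_f'f.
Proof. by apply/rowP => i; rewrite !mxE; exact: lie_rhs1E. Qed.

Lemma lie_rhs2E F : S F ->
  LF (LF F) x0 = form1 (coef1 F) el_f'f + form2 (coef2 F) el_f el_f.
Proof. by move=> sF; rewrite (lie_rhs2 ac sF cx0) row_lie_rhs1. Qed.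

Lemma lie_rhs3E F : S F -> LF (LF (LF F)) x0 =
  form1 (coef1 F) el_f''ff + form1 (coef1 F) el_f'f'f +
  (2 * form2 (coef2 F) el_f el_f'f + form2 (coef2 F) el_f'f el_f + form3 (coef3 F) el_f el_f el_f).
Proof.
move=> sF; rewrite (lie_rhs3 ac sF cx0) row_lie_rhs1; congr (_ + _).
rewrite -form1D; congr (form1 _ _); apply/rowP => i.
by rewrite !mxE (lie_rhs2E (sf i)) addrC.
Qed.

Lemma exact_ex3 F y : S F -> exact_solution p y ->
  Oh 3 (fun h => F (fwd c (y h)) - (F x0 + h * form1 (coef1 F) el_f +
    h ^+ 2 / 2 * (form1 (coef1 F) el_f'f + form2 (coef2 F) el_f el_f))).
Proof.
move=> sF Hy; apply: Oh_near (taylor_exact ac cx0 3 cp erefl Hy sF).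
by near=> h; rewrite taylor_poly3 /= lie_rhs1E lie_rhs2E.
Unshelve. all: by end_near. Qed.

Lemma exact_ex4 F y : S F -> exact_solution p y ->
  Oh 4 (fun h => F (fwd c (y h)) - (F x0 + h * form1 (coef1 F) el_f +
    h ^+ 2 / 2 * (form1 (coef1 F) el_f'f + form2 (coef2 F) el_f el_f) +
    h ^+ 3 / 6 * (form1 (coef1 F) el_f''ff + form1 (coef1 F) el_f'f'f +
      (2 * form2 (coef2 F) el_f el_f'f + form2 (coef2 F) el_f'f el_f +
       form3 (coef3 F) el_f el_f el_f)))).
Proof.
move=> sF Hy; apply: Oh_near (taylor_exact ac cx0 4 cp erefl Hy sF).
by near=> h; rewrite taylor_poly4 /= lie_rhs1E lie_rhs2E // lie_rhs3E.
Unshelve. all: by end_near. Qed.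

Lemma tends_cst : tends c x0 (fun=> p).
Proof. by split; [near=> h|exact: cvg_cst]. Unshelve. all: by end_near. Qed.

Lemma flow_ex3 F (u : R -> lieAlg G) s0 s1 : S F -> expands2 el_f el_f'f u s0 s1 ->
  Oh 3 (fun h => F (fwd c (flow_at (u h) h p)) -
    (F x0 + h * (s0 * form1 (coef1 F) el_f + h * s1 * form1 (coef1 F) el_f'f) +
     h ^+ 2 / 2 * (s0 * s0 * form2 (coef2 F) el_f el_f))).
Proof.
move=> sF Hu; have Hu1 := expands21 Hu; have Hu0 := expands10 Hu1.
have T := taylor_flow ac cx0 3 Hu0 tends_cst (bfam_cst sF).
have H1 := OhXM 1 (form1_ex2 (coef1 F) Hu).
have H2 := OhMr (1 / 2) (OhXM 2 (form2_ex1 (coef2 F) Hu1 Hu1)).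
apply: Oh_near (OhD T (OhD H1 H2)); near=> h.
rewrite taylor_poly3 /= (lie1E F) (lie2E _ _ sF); by field.
Unshelve. all: by end_near. Qed.

(** The flow lasts for time h, which gains one power: an exponent known up to O(h^2) gives the stage
    up to O(h^3). *)
Lemma stage_ex3 (u : R -> lieAlg G) s0 s1 : expands2 el_f el_f'f u s0 s1 ->
  expands3 el_f el_f'f (fun h => rhs (flow_at (u h) h p)) 1 s0
    (s1 *: el_f'f'f + (s0 ^+ 2 / 2) *: el_f''ff).
Proof.
move=> Hu; apply: Oh_rV => i.
have [tD _] := tends_flow ac cx0 (expands10 (expands21 Hu)) tends_cst.
apply: Oh_near (flow_ex3 (sf i) Hu); apply: filterS tD => h dh.
rewrite /= /rhs_chart (fwdK dh) !mxE -/(rhs_chart c x0) -/el_f; ring.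
Qed.

Variables (w v : R -> lieAlg G).

(** [F] is expanded along the last flow from the intermediate point, and each coefficient is then
    expanded along the first flow from [p]. Hence derivatives along [w] are applied to [F] before
    those along [v]. *)
Lemma double_flow K F : Oh 0 w -> Oh 0 v -> S F ->
  Oh K (fun h => F (fwd c (flow_at (w h) h (flow_at (v h) h p))) -
    \sum_(k < K) h ^+ k / k`!%:R *
      taylor_poly (K - k) (fun l => iter l (L (v h)) (iter k (L (w h)) F) x0) h).
Proof.
move=> Hw Hv sF; have tq := tends_flow ac cx0 Hv tends_cst.
have T := taylor_flow ac cx0 K Hw tq (bfam_cst sF).
(* These coefficients vary with h through [w h], so Taylor's formula is needed for families and not
   only for fixed functions. *)
have T2 (k : 'I_K) := OhXM k (taylor_flow ac cx0 (K - k) Hv tends_cst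
  (bfam_lie_iter ac k Hw (bfam_cst sF))).
have T3 : Oh K (fun h => \sum_(k < K) (k`!%:R)^-1 * (h ^+ k * (
    iter k (L (w h)) F (fwd c (flow_at (v h) h p)) -
    taylor_poly (K - k) (fun l => iter l (L (v h)) (iter k (L (w h)) F) x0) h))).
  apply: Oh_sum => k; apply: OhMr; have := T2 k.
  by rewrite subnKC // ltnW.
apply: Oh_near (OhD T T3); near=> h.
rewrite -addrA; congr (_ + _); rewrite /taylor_poly addrC -sumrB -sumrN.
apply: eq_bigr => k _; ring.
Unshelve. all: by end_near. Qed.

Lemma double_flow_ex2 F s0 s1 t0 t1 :
  expands2 el_f el_f'f w s0 s1 -> expands2 el_f el_f'f v t0 t1 ->
  S F -> Oh 2 (fun h => F (fwd c (flow_at (w h) h (flow_at (v h) h p))) -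
    (F x0 + h * ((s0 + t0) * form1 (coef1 F) el_f))).
Proof.
move=> Hw Hv sF; have T := double_flow 2 (expands10 (expands21 Hw)) (expands10 (expands21 Hv)) sF.
have H1 := OhXM 1 (form1_ex1 (coef1 F) (expands21 Hw)).
have H2 := OhXM 1 (form1_ex1 (coef1 F) (expands21 Hv)).
apply: Oh_near (OhD T (OhD H1 H2)); near=> h.
rewrite !big_ord_recr big_ord0 /= taylor_poly2 taylor_poly1 /=.
by rewrite !lie1E !factS fact0 expr0 expr1; field.
Unshelve. all: by end_near. Qed.

(** The coefficients of the two mixed second-order forms differ by [t0 * s1 - t1 * s0], the
    contribution of the commutator of the two exponents. *)
Lemma double_flow_ex4 F s0 s1 r t0 t1 q :
  expands3 el_f el_f'f w s0 s1 r -> expands3 el_f el_f'f v t0 t1 q -> S F ->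
  Oh 4 (fun h => F (fwd c (flow_at (w h) h (flow_at (v h) h p))) -
    (F x0 + h * ((s0 + t0) * form1 (coef1 F) el_f) +
     h ^+ 2 * ((s1 + t1) * form1 (coef1 F) el_f'f +
       (s0 + t0) ^+ 2 / 2 * form2 (coef2 F) el_f el_f) +
     h ^+ 3 * (form1 (coef1 F) r + form1 (coef1 F) q +
       (s0 * s1 / 2 + t0 * s1 + t0 * t1 / 2) * form2 (coef2 F) el_f el_f'f +
       (s0 * s1 / 2 + t1 * s0 + t0 * t1 / 2) * form2 (coef2 F) el_f'f el_f +
       (s0 + t0) ^+ 3 / 6 * form3 (coef3 F) el_f el_f el_f))).
Proof.
move=> Hw3 Hv3 sF; have Hw2 := expands32 Hw3; have Hv2 := expands32 Hv3.
have Hw1 := expands21 Hw2; have Hv1 := expands21 Hv2.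
have T := double_flow 4 (expands10 Hw1) (expands10 Hv1) sF.
have A1 := OhXM 1 (form1_ex3 (coef1 F) Hw3).
have A2 := OhXM 1 (form1_ex3 (coef1 F) Hv3).
have B1 := OhMr (1 / 2) (OhXM 2 (form2_ex2 (coef2 F) Hw2 Hw2)).
have B2 := OhXM 2 (form2_ex2 (coef2 F) Hv2 Hw2).
have B3 := OhMr (1 / 2) (OhXM 2 (form2_ex2 (coef2 F) Hv2 Hv2)).
have C1 := OhMr (1 / 6) (OhXM 3 (form3_ex1 (coef3 F) Hw1 Hw1 Hw1)).
have C2 := OhMr (1 / 2) (OhXM 3 (form3_ex1 (coef3 F) Hv1 Hw1 Hw1)).
have C3 := OhMr (1 / 2) (OhXM 3 (form3_ex1 (coef3 F) Hv1 Hv1 Hw1)).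
have C4 := OhMr (1 / 6) (OhXM 3 (form3_ex1 (coef3 F) Hv1 Hv1 Hv1)).
have AB := OhD (OhD A1 A2) (OhD B1 (OhD B2 B3)).
apply: Oh_near (OhD T (OhD AB (OhD (OhD C1 C2) (OhD C3 C4)))); near=> h.
rewrite !big_ord_recr big_ord0 /=.
rewrite taylor_poly4 taylor_poly3 taylor_poly2 taylor_poly1 /=.
rewrite !(lie3E _ _ _ sF) !(lie2E _ _ sF) !lie1E !factS fact0 expr0 expr1; by field.
Unshelve. all: by end_near. Qed.

End LocalExpansions.

Lemma eqO_Oh {R : realType} (k : nat) (g : R -> R) :
  g =O_ (0 : R) (fun h : R => h ^+ k) <-> Oh k g.
Proof.
split=> [/eqO_exP[C C0 HC]|/Oh_ge0[C C0 HC]].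
  by exists C; apply: filterS HC => h; rewrite normrX.
apply/eqO_exP; exists (C + 1); first by rewrite ltr_wpDl.
apply: filterS HC => h /le_trans; apply.
by rewrite normrX ler_wpM2r ?exprn_ge0 // lerDl.
Qed.

(** The first four are the classical conditions of order 3. Given the first two of them, the fifth
    is equivalent to the coefficient of the form in (f, f'f) being 1/3. *)
Definition order3_conditions {R : realType} (C : cfcoef R) : Prop :=
  [/\ al1 C + al2 C + (be1 C + be2 C + be3 C) = 1,
      (al2 C + be2 C) * ca C + be3 C * (al1 C + al2 C) = 1 / 2,
      (al2 C + be2 C) * ca C ^+ 2 + be3 C * (al1 C + al2 C) ^+ 2 = 1 / 3,
      be3 C * (al2 C * ca C) = 1 / 6 &
      6 * (al2 C * ca C) = 1 + 3 * (al1 C + al2 C)].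

(** * Sufficiency of the order conditions *)

Section Sufficiency.
Context {R : realType}.
Implicit Types C : cfcoef R.

Section Local.
Variables (P : problem R) (p : mfd P) (c : chart R (mfd P) (mdim (mfd P))).
Hypotheses (ac : atlas c) (cp : dom c p).
Local Notation el_f := (el_f c p).
Local Notation el_f'f := (el_f'f c p).
Local Notation el_f''ff := (el_f''ff c p).
Local Notation el_f'f'f := (el_f'f'f c p).
Local Notation expands2 := (expands2 el_f el_f'f).
Local Notation expands3 := (expands3 el_f el_f'f).

Lemma expands3_eq s s0 s1 r s0' s1' r' : expands3 s s0 s1 r ->
  s0 = s0' -> s1 = s1' -> r = r' -> expands3 s s0' s1' r'.
Proof. by move=> H <- <- <-. Qed.

Lemma stage1E h : stage1 h p = el_f :> lieAlg (grp P).
Proof. by rewrite (el_fE cp) /stage1 act_one. Qed.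

Lemma stage1_ex3 : expands3 (fun h => stage1 h p) 1 0 0.
Proof.
by apply: Oh_near (expands3_f0 el_f el_f'f); near=> h; rewrite stage1E.
Unshelve. all: by end_near. Qed.

Lemma stage2_ex3 C : expands3 (fun h => stage2 C h p) 1 (ca C) ((ca C ^+ 2 / 2) *: el_f''ff).
Proof.
have H := expands32 (expands3Z (ca C) stage1_ex3).
apply: (expands3_eq (stage_ex3 ac cp H)) => //; first by rewrite mulr1.
by rewrite mulr0 scale0r add0r mulr1.
Qed.

Definition arg3 C (h : R) : lieAlg (grp P) :=
  al1 C *: stage1 h p + al2 C *: stage2 C h p.

Lemma arg3_ex3 C : expands3 (arg3 C) (al1 C + al2 C) (al2 C * ca C)
  ((al2 C * ca C ^+ 2 / 2) *: el_f''ff).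
Proof.
have H := expands3D (expands3Z (al1 C) stage1_ex3) (expands3Z (al2 C) (stage2_ex3 C)).
apply: (expands3_eq H); first by rewrite !mulr1.
  by rewrite mulr0 add0r.
by rewrite scaler0 add0r scalerA mulrA.
Qed.

Lemma stage3_ex3 C : expands3 (fun h => stage3 C h p) 1 (al1 C + al2 C)
  ((al2 C * ca C) *: el_f'f'f + ((al1 C + al2 C) ^+ 2 / 2) *: el_f''ff).
Proof. exact: (stage_ex3 ac cp (expands32 (arg3_ex3 C))). Qed.

Definition arg4 C (h : R) : lieAlg (grp P) :=
  be1 C *: stage1 h p + be2 C *: stage2 C h p + be3 C *: stage3 C h p.

Lemma arg4_ex3 C : expands3 (arg4 C) (be1 C + be2 C + be3 C)
  (be2 C * ca C + be3 C * (al1 C + al2 C))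
  ((be2 C * ca C ^+ 2 / 2 + be3 C * (al1 C + al2 C) ^+ 2 / 2) *: el_f''ff +
   (be3 C * (al2 C * ca C)) *: el_f'f'f).
Proof.
have H := expands3D (expands3D (expands3Z (be1 C) stage1_ex3) (expands3Z (be2 C) (stage2_ex3 C)))
  (expands3Z (be3 C) (stage3_ex3 C)).
apply: (expands3_eq H); first by rewrite !mulr1.
  by rewrite mulr0 add0r.
by apply/rowP => i; rewrite !mxE; ring.
Qed.

(** A left action turns the product of exponentials into a composition in which the right factor
    flows first. *)
Lemma updateE C h : update C h p = flow_at (arg3 C h) h (flow_at (arg4 C h) h p).
Proof. by rewrite /update act_mul. Qed.

Lemma update_tends C : tends c (fwd c p) (fun h => update C h p).
Proof.
have t0 := tends_cst cp.
have t1 := tends_flow ac (fwd_img cp) (expands10 (expands21 (expands32 (arg4_ex3 C)))) t0.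
have := tends_flow ac (fwd_img cp) (expands10 (expands21 (expands32 (arg3_ex3 C)))) t1.
have -> // : (fun h => flow_at (arg3 C h) h (flow_at (arg4 C h) h p)) =
  (fun h => update C h p) by apply/funext => h; rewrite updateE.
Qed.

Lemma stage4_ex2 C : expands2 (fun h => stage4 C h p) 1
  (al1 C + al2 C + (be1 C + be2 C + be3 C)).
Proof.
apply: Oh_rV => i; have [tD _] := update_tends C.
have H := double_flow_ex2 ac cp (expands32 (arg3_ex3 C))
  (expands32 (arg4_ex3 C)) (smooth_rhs (c := c) ac i).
apply: Oh_near H; apply: filterS tD => h dh.
rewrite -updateE /stage4 /rhs_chart (fwdK dh) !mxE -/(rhs_chart c (fwd c p)) -/el_f; ring.
Qed.

Lemma exact_near y : exact_solution p y -> \forall h \near (0 : R), dom c (y h).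
Proof.
move=> [y0 Hy]; have [cy0 _] := nbhs_singleton Hy.
apply: (cy0 (dom c)); apply: open_nbhs_nbhs; split; first exact: dom_open.
by rewrite y0.
Qed.

End Local.

Lemma order3_sufficient C : order3_conditions C -> has_order 3 (update C).
Proof.
move=> [k1 k2 k3 k4 k5] P p y psi Hy spsi; apply/eqO_Oh.
have [c ac cp] := atlas_cover p.
have sF : smooth_on (img c) (psi \o bwd c) by exact: spsi.
have X := exact_ex4 ac cp sF Hy.
have U := double_flow_ex4 ac cp (arg3_ex3 ac cp C) (arg4_ex3 ac cp C) sF.
have [tU _] := update_tends ac cp C.
apply: Oh_near (OhB X U); apply: filterS2 (exact_near cp Hy) tU => h dy du.
rewrite -updateE /= (fwdK dy) (fwdK du) (fwdK cp) k1.
rewrite !form1D !form1Z.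
set A := al2 C * ca C; set B := be2 C * ca C + be3 C * (al1 C + al2 C).
set s := al1 C + al2 C; set t := be1 C + be2 C + be3 C.
have AB : A + B = 1 / 2 by rewrite -k2 /A /B; ring.
(* The coefficient of the form in (f, f'f); the first, second and fifth conditions express t, B and
   s through A. *)
have e1 : s * A / 2 + t * A + t * B / 2 = 1 / 3.
  have -> : t = 1 - s by rewrite -k1 /s /t; ring.
  have -> : B = 1 / 2 - A by rewrite -AB; ring.
  have -> : s = (6 * A - 1) / 3 by rewrite k5 -/s; field.
  by field.
(* The two mixed coefficients add up to (s + t)(A + B) = 1/2, so this one follows from [e1]. *)
have e2 : s * A / 2 + B * s + t * B / 2 = 1 / 6.
  have -> : s * A / 2 + B * s + t * B / 2 =
    (s + t) * (A + B) - (s * A / 2 + t * A + t * B / 2) by field.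
  rewrite e1 AB k1; by field.
have e3 : al2 C * ca C ^+ 2 / 2 + (be2 C * ca C ^+ 2 / 2 + be3 C * s ^+ 2 / 2) = 1 / 6.
  have -> : al2 C * ca C ^+ 2 / 2 + (be2 C * ca C ^+ 2 / 2 + be3 C * s ^+ 2 / 2) =
    ((al2 C + be2 C) * ca C ^+ 2 + be3 C * s ^+ 2) / 2 by field.
  by rewrite k3; field.
rewrite AB e1 e2 [be3 C * A]k4.
move: e3; set a1 := al2 C * ca C ^+ 2 / 2.
set a2 := be2 C * ca C ^+ 2 / 2 + _ => e3.
have -> : a1 = 1 / 6 - a2 by rewrite -e3; ring.
by field.
Qed.

Lemma sum4 (F : 'I_4 -> R) : \sum_k F k = F 0 + F 1 + F 2 + F 3.
Proof.
rewrite !big_ord_recl big_ord0 addr0 !addrA.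
by congr (F _ + F _ + F _ + F _); apply/val_inj.
Qed.

Lemma classical_order2E (b : 'rV[R]_4) C : classical_order2 b (abscissae C) <->
  b 0 0 + b 0 1 + b 0 2 + b 0 3 = 1 /\
  b 0 1 * ca C + b 0 2 * (al1 C + al2 C) + b 0 3 = 1 / 2.
Proof.
rewrite /classical_order2 !sum4 /abscissae !mxE /= mulr0 add0r mulr1.
by [].
Qed.

(** With a single exponential, the only second-order form up to h^2 is the one in (f, f), so just
    the two classical conditions arise. Consistency of the update makes 1 the abscissa of f4. *)
Lemma order2_sufficient C (bh : 'rV[R]_4) :
  al1 C + al2 C + (be1 C + be2 C + be3 C) = 1 ->
  classical_order2 bh (abscissae C) -> has_order 2 (embedded C bh).
Proof.
move=> k1 /classical_order2E[b1 b2] P p y psi Hy spsi; apply/eqO_Oh.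
have [c ac cp] := atlas_cover p.
have sF : smooth_on (img c) (psi \o bwd c) by exact: spsi.
have X := exact_ex3 ac cp sF Hy.
pose u h : lieAlg (grp P) := bh 0 0 *: stage1 h p + bh 0 1 *: stage2 C h p
  + bh 0 2 *: stage3 C h p + bh 0 3 *: stage4 C h p.
have Hu := expands2D (expands2D (expands2D (expands2Z (bh 0 0) (expands32 (stage1_ex3 cp)))
  (expands2Z (bh 0 1) (expands32 (stage2_ex3 ac cp C))))
  (expands2Z (bh 0 2) (expands32 (stage3_ex3 ac cp C)))) (expands2Z (bh 0 3) (stage4_ex2 ac cp C)).
have U := flow_ex3 ac cp sF Hu.
have [tU _] := tends_flow ac (fwd_img cp) (expands10 (expands21 Hu)) (tends_cst cp).
apply: Oh_near (OhB X U); apply: filterS2 (exact_near cp Hy) tU => h dy du.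
rewrite /= (fwdK dy) (fwdK du) !mulr1 mulr0 add0r k1 b1 mulr1 b2.
rewrite -[embedded C bh h p]/(flow_at (u h) h p) /u.
by field.
Qed.

End Sufficiency.

(** * Necessity of the order conditions *)

Section SmoothOn.
Context {R : realType}.
Implicit Types V W : normedModType R.

Lemma smooth_on_linear V W (D : set V) (f : V -> W) :
  linear f -> continuous f -> smooth_on D f.
Proof.
move=> fl fc k.
pose L : {linear V -> W} := HB.pack f (GRing.isLinear.Build _ _ _ _ f fl).
exact: (@Ck_on_lin _ _ _ k D L fc).
Qed.

Lemma smooth_onS V W (D D' : set V) (f : V -> W) :
  D `<=` D' -> smooth_on D' f -> smooth_on D f.
Proof. by move=> DD H k; apply: Ck_onS DD _. Qed.

Lemma smooth_on_cst V W (D : set V) (a : W) : smooth_on D (fun=> a).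
Proof. by move=> k; exact: Ck_on_cst. Qed.

Lemma smooth_onD V W (D : set V) (f g : V -> W) : open D ->
  smooth_on D f -> smooth_on D g -> smooth_on D (fun x => f x + g x).
Proof. by move=> oD Hf Hg k; apply: Ck_onD. Qed.

Lemma smooth_onM V (D : set V) (f g : V -> R) : open D ->
  smooth_on D f -> smooth_on D g -> smooth_on D (fun x => f x * g x).
Proof. by move=> oD Hf Hg k; apply: Ck_onM. Qed.

Lemma smooth_onZl V W (D : set V) (f : V -> R) (w : W) : open D ->
  smooth_on D f -> smooth_on D (fun x => f x *: w).
Proof. by move=> oD Hf k; apply: Ck_onZl. Qed.

Lemma smooth_on_id V (D : set V) : smooth_on D (fun x : V => x).
Proof. by apply: smooth_on_linear => [a x y|x] //; exact: cvg_id. Qed.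

Lemma smooth_on_fst V W (D : set (V * W)) : smooth_on D (fun z : V * W => z.1).
Proof. by apply: smooth_on_linear => // z; exact: cvg_fst. Qed.

Lemma smooth_on_snd V W (D : set (V * W)) : smooth_on D (fun z : V * W => z.2).
Proof. by apply: smooth_on_linear => // z; exact: cvg_snd. Qed.

Lemma smooth_onT_continuous V W (f : V -> W) : smooth_on setT f -> continuous f.
Proof. by move=> H x; exact: (H 0%N). Qed.

End SmoothOn.

(** * Row vectors as a manifold *)

Section RowManifold.
Context {R : realType} (n : nat).

Lemma rat_approx (a r : R) : 0 < r -> exists q : rat, `|ratr q - a| < r.
Proof.
move=> r0; have /rat_in_itvoo[q] : a - r < a + r by lra.
rewrite in_itv /= => /andP[q1 q2]; exists q.
by rewrite ltr_norml; apply/andP; split; lra.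
Qed.

Lemma rV_second_countable : @second_countable ('rV[R]_n).
Proof.
pose U (z : 'rV[rat]_n * nat) : set 'rV[R]_n :=
  @ball R 'rV[R]_n (map_mx (ratr : rat -> R) z.1) z.2.+1%:R^-1.
exists (range U).
  by apply: sub_countable (card_image_le _ _) _; exact: countableP.
split=> [_ [z _ <-]|x V /nbhs_ballP[e /= e0 eV]]; first exact: ball_open.
have [N] := @ltr_add_invr R 0 (e / 2) (divr_gt0 e0 (ltr0Sn _ 1)).
rewrite add0r => Ne; have N0 : 0 < (N.+1%:R^-1 : R) by [].
have /choice[q Hq] j := rat_approx (x 0 j) N0.
have Uq : @ball R 'rV[R]_n (map_mx (ratr : rat -> R) (\row_j q j)) N.+1%:R^-1 x.
  by split=> // i j; rewrite (ord1 i) !mxE; exact: Hq.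
exists (U (\row_j q j, N)); first by split => //; exists (\row_j q j, N).
move=> y Uy; apply: eV; apply: le_ball (ltW _) _ _; last first.
  exact: ball_triangle (ball_sym Uq) Uy.
by rewrite [ltRHS]splitr ltrD.
Qed.

(** This chart and [rV_manifold] are transparent, so that the domain computes to the whole space and
    [I] and [erefl] are accepted as proofs in [heis]. *)
Definition rV_chart : chart R 'rV[R]_n n.
Proof.
by refine (@Chart R 'rV[R]_n n setT setT id id _ _ _ _ _ _ _ _);
  try exact: openT; move=> q _ //; exact: cvg_id.
Defined.

Definition rV_manifold : manifold R.
Proof.
refine (@Manifold R 'rV[R]_n n [set rV_chart] _ rV_second_countable _ _).
- exact: norm_hausdorff.
- by move=> q; exists rV_chart.
- by move=> _ _ -> ->; exact: smooth_on_id.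
Defined.

End RowManifold.

(** * The test problem on the product of the Heisenberg group and the plane *)

Section TestProblem.
Context {R : realType}.
Local Notation V := 'rV[R]_5.

Definition j0 : 'I_5 := Ordinal (isT : 0 < 5)%N.
Definition j1 : 'I_5 := Ordinal (isT : 1 < 5)%N.
Definition j2 : 'I_5 := Ordinal (isT : 2 < 5)%N.
Definition j3 : 'I_5 := Ordinal (isT : 3 < 5)%N.
Definition j4 : 'I_5 := Ordinal (isT : 4 < 5)%N.

Definition bas (j : 'I_5) : V := delta_mx 0 j.

Lemma basE i j : bas i 0 j = ((j : nat) == i)%:R.
Proof. by rewrite mxE eqxx. Qed.

(** Coordinates 0, 1, 2 multiply like the entries (1,2), (2,3), (1,3) of upper unitriangular 3 by 3
    matrices; coordinates 3 and 4 form an additive plane. *)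
Definition heis_mul (g k : V) : V := g + k + (g 0 j0 * k 0 j1) *: bas j2.
Definition heis_inv (g : V) : V := - g + (g 0 j0 * g 0 j1) *: bas j2.

Lemma row_addE (a b : V) i : (a + b) 0 i = a 0 i + b 0 i.
Proof. by rewrite mxE. Qed.

Lemma row_oppE (a : V) i : (- a) 0 i = - a 0 i.
Proof. by rewrite mxE. Qed.

Lemma row_scaleE (r : R) (a : V) i : (r *: a) 0 i = r * a 0 i.
Proof. by rewrite mxE. Qed.

Lemma row_zeroE i : (0 : V) 0 i = 0.
Proof. by rewrite mxE. Qed.

Definition entryE := (row_addE, row_oppE, row_scaleE, row_zeroE).

Lemma heis_mulE g k i : heis_mul g k 0 i = g 0 i + k 0 i + g 0 j0 * k 0 j1 * ((i : nat) == 2)%:R.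
Proof. by rewrite !entryE basE. Qed.

Lemma heis_mulA : associative heis_mul.
Proof.
move=> x y z; apply/rowP => i; rewrite !heis_mulE /= !mulr0 !addr0; ring.
Qed.

Lemma heis_mul1 : left_id 0 heis_mul.
Proof. by move=> x; apply/rowP => i; rewrite heis_mulE !entryE; ring. Qed.

Lemma heis_mulV : left_inverse 0 heis_inv heis_mul.
Proof.
move=> x; apply/rowP => i; rewrite heis_mulE !entryE !basE /= !mulr0 !addr0.
by ring.
Qed.

Lemma smooth_heis_mul D : open D -> smooth_on D (fun z : V * V => heis_mul z.1 z.2).
Proof.
move=> oD; apply: smooth_onD => //.
  by apply: smooth_onD => //; [exact: smooth_on_fst|exact: smooth_on_snd].
apply: smooth_onZl => //; apply: smooth_onM => //; apply: smooth_on_coord => //.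
  exact: smooth_on_fst.
exact: smooth_on_snd.
Qed.

Lemma smooth_heis_inv D : open D -> smooth_on D heis_inv.
Proof.
move=> oD; apply: smooth_onD => //.
  apply: smooth_on_linear => [a x y|x]; last exact: opp_continuous.
  by rewrite scalerN opprD.
by apply: smooth_onZl => //; apply: smooth_onM => //; apply: smooth_on_coord => //;
  exact: smooth_on_id.
Qed.

Lemma heis_mul_smooth : smooth_map2 (M := rV_manifold 5) (N := rV_manifold 5)
  (P := rV_manifold 5) heis_mul.
Proof.
split; first exact: (smooth_onT_continuous (smooth_heis_mul openT)).
move=> _ _ _ -> -> ->; apply: (smooth_onS (D' := setT)) => //.
exact: (smooth_heis_mul openT).
Qed.

Lemma heis_inv_smooth :
  smooth_map (M := rV_manifold 5) (N := rV_manifold 5) heis_inv.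
Proof.
split; first exact: (smooth_onT_continuous (smooth_heis_inv openT)).
move=> _ _ -> ->; apply: (smooth_onS (D' := setT)) => //.
exact: (smooth_heis_inv openT).
Qed.

Definition heis : lieGroup R :=
  @LieGroup R (rV_manifold 5) heis_mul heis_inv (0 : V) heis_mulA heis_mul1
    heis_mulV heis_mul_smooth heis_inv_smooth (rV_chart 5) erefl I.

(** The matrix exponential, whose series stops at the quadratic term because the matrices are
    nilpotent. *)
Definition heis_exp (u : V) : V := u + (u 0 j0 * u 0 j1 / 2) *: bas j2.

Lemma heis_expE u i : heis_exp u 0 i = u 0 i + u 0 j0 * u 0 j1 / 2 * ((i : nat) == 2)%:R.
Proof. by rewrite !entryE basE. Qed.

(** The one-parameter subgroups, the flows and the exact solution of the test problem all have this
    form, so smoothness and derivatives are computed once. *)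
Definition cubic (a b c d : V) (t : R) : V :=
  a + t *: b + t ^+ 2 *: c + t ^+ 3 *: d.

Lemma smooth_cubic a b c d D : open D -> smooth_on D (cubic a b c d).
Proof.
move=> oD; have sX n : smooth_on D (fun t : R => t ^+ n).
  elim: n => [|n IH].
    rewrite (_ : (fun t : R => t ^+ 0) = fun=> 1); first exact: smooth_on_cst.
    by apply/funext => t; rewrite expr0.
  rewrite (_ : (fun t : R => t ^+ n.+1) = fun t => t * t ^+ n).
    by apply: smooth_onM => //; exact: smooth_on_id.
  by apply/funext => t; rewrite exprS.
apply: smooth_onD => //; last exact: smooth_onZl.
apply: smooth_onD => //; last exact: smooth_onZl.
apply: smooth_onD => //; first exact: smooth_on_cst.
by apply: smooth_onZl => //; exact: smooth_on_id.
Qed.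

Lemma is_derive_cubic a b c d (s : R) : is_derive s 1 (cubic a b c d)
  (b + (2 * s) *: c + (3 * s ^+ 2) *: d).
Proof.
have dX n : is_derive s 1 (fun t : R => t ^+ n) (n%:R * s ^+ n.-1).
  apply: DeriveDef; first exact: exprn_derivable.
  by rewrite exp_derive /= -[LHS]/(_ * 1) mulr1.
have dZ n (w : V) : is_derive s 1 (fun t : R => t ^+ n *: w) ((n%:R * s ^+ n.-1) *: w).
  have := is_derive_comp (F := fun r : R => r *: w) (f := fun t : R => t ^+ n) _ (dX n).
  have dl : is_diff (s ^+ n) (fun r : R => r *: w) (fun r : R => r *: w).
    exact: is_diff_scalel.
  by rewrite diff_val; apply; case: dl.
have := is_deriveD (is_deriveD (is_deriveD (is_derive_cst a s 1) (dZ 1%N b)) (dZ 2%N c)) (dZ 3%N d).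
rewrite /= add0r expr0 mulr1 expr1 scale1r.
by [].
Qed.

Lemma heis_exp_curve u : (fun t : R => heis_exp (t *: u)) =
  cubic 0 u ((u 0 j0 * u 0 j1 / 2) *: bas j2) 0.
Proof.
apply/funext => t; apply/rowP => i.
by rewrite heis_expE /cubic !entryE basE; ring.
Qed.

Lemma heis_expP : is_exponential (G := heis) heis_exp.
Proof.
move=> u; split.
- rewrite heis_exp_curve; split.
    exact: (smooth_onT_continuous (smooth_cubic _ _ _ _ openT)).
  move=> _ ->; apply: (smooth_onS (D' := setT)) => //.
  exact: (smooth_cubic _ _ _ _ openT).
- move=> s t; apply/rowP => i; rewrite [RHS]heis_mulE !heis_expE !entryE /=.
  by rewrite !mulr0 !addr0; field.
- have := is_derive_cubic 0 u ((u 0 j0 * u 0 j1 / 2) *: bas j2) 0 0.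
  by rewrite -heis_exp_curve mulr0 scale0r expr0n mulr0 scale0r !addr0.
Qed.

Lemma heis_actP : is_action (G := heis) (M := rV_manifold 5) heis_mul.
Proof.
split; [exact: heis_mul1| |exact: heis_mul_smooth].
by move=> g k q; rewrite [RHS]heis_mulA.
Qed.

(* The coordinates 0, ..., 4 of one step from the origin isolate, in this      *)
(* order, the conditions on sum b_i, sum b_i c_i, the noncommutativity,        *)
(* b3 al2 a and sum b_i c_i^2.                                                 *)
Definition test_rhs (q : V) : V :=
  bas j0 + q 0 j0 *: bas j1 + q 0 j1 *: bas j3 + (q 0 j0 * q 0 j0) *: bas j4.

Lemma test_rhs_smooth : smooth_fun (M := rV_manifold 5) test_rhs.
Proof.
move=> _ ->; rewrite -[X in smooth_on _ X]/test_rhs.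
have sc j : smooth_on [set: V] (fun q : V => q 0 j).
  by apply: smooth_on_coord; [exact: openT|exact: smooth_on_id].
apply: smooth_onD; [exact: openT| |].
  apply: smooth_onD; [exact: openT| |].
    apply: smooth_onD; [exact: openT|exact: smooth_on_cst|].
    by apply: smooth_onZl => //; exact: openT.
  by apply: smooth_onZl => //; exact: openT.
apply: smooth_onZl; first exact: openT.
by apply: smooth_onM => //; exact: openT.
Qed.

Definition test_problem : problem R :=
  @Problem R heis heis_exp heis_expP (rV_manifold 5) heis_mul heis_actP
    test_rhs test_rhs_smooth.

Definition test_solution : R -> V :=
  cubic 0 (bas j0) (2^-1 *: bas j1)
    (6^-1 *: bas j2 + 6^-1 *: bas j3 + 3^-1 *: bas j4).

Lemma test_flow (u q : V) :
  (fun s : R => heis_mul (heis_exp (s *: u)) q) =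
  cubic q (u + (u 0 j0 * q 0 j1) *: bas j2) ((u 0 j0 * u 0 j1 / 2) *: bas j2) 0.
Proof.
apply/funext => s; apply/rowP => i.
by rewrite /cubic heis_mulE !heis_expE !entryE basE /=; ring.
Qed.

Lemma test_inf_action (u q : V) :
  inf_action (P := test_problem) (rV_chart 5) u q = u + (u 0 j0 * q 0 j1) *: bas j2.
Proof.
rewrite /inf_action -[X in derive1 X]/(fun s : R => heis_mul (heis_exp (s *: u)) q).
rewrite test_flow derive1E.
have /@derive_val -> := is_derive_cubic q (u + (u 0 j0 * q 0 j1) *: bas j2)
  ((u 0 j0 * u 0 j1 / 2) *: bas j2) 0 0.
by rewrite mulr0 expr0n mulr0 !scale0r !addr0.
Qed.

Lemma test_solutionP :
  exact_solution (P := test_problem) (0 : V) test_solution.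
Proof.
split; first by apply/rowP => i; rewrite /test_solution /cubic !entryE; ring.
near=> t; split.
  exact: (smooth_onT_continuous (smooth_cubic _ _ _ _ openT)).
move=> _ -> _; rewrite -[_ \o _]/test_solution test_inf_action.
apply: is_derive_eq (is_derive_cubic _ _ _ _ t) _.
apply/rowP => i; rewrite /test_rhs /test_solution /cubic !entryE !basE /=.
by field.
Unshelve. all: by end_near. Qed.

End TestProblem.

(** * Reading the order conditions off the test problem *)

Section Necessity.
Context {R : realType}.
Local Notation V := 'rV[R]_5.
Local Notation TP := (@test_problem R).
Local Notation O := ((0 : V) : mfd TP).

Lemma Oh_monomial_eq0 (k : nat) (a : R) : Oh k.+1 (fun h : R => h ^+ k * a) -> a = 0.
Proof.
move=> /Oh_ge0[C C0 HC]; apply: contrapT => /eqP a0.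
have [e /= e0 He] := HC.
(* For this h > 0 the bound |a| <= C h contradicts 2 (C + 1) h <= |a|. *)
pose h := Num.min (e / 2) (`|a| / (2 * (C + 1))).
have a0' : 0 < `|a| by rewrite normr_gt0.
have C1 : 0 < 2 * (C + 1) by lra.
have h0 : 0 < h by rewrite lt_min !divr_gt0.
have he : h < e by rewrite gt_min ltr_pdivrMr // ltr_pMr // ltr1n.
have hC : h * (2 * (C + 1)) <= `|a|.
  by rewrite -ler_pdivlMr // ge_min lexx orbT.
have := He h; rewrite /ball_ /= sub0r normrN (gtr0_norm h0) => /(_ he).
rewrite normrM normrX (gtr0_norm h0) exprSr mulrCA ler_pM2l ?exprn_gt0 //.
move=> aC; have : `|a| < `|a|; last by rewrite ltxx.
nra.
Qed.

Lemma heis_mulr0 (g : V) : heis_mul g 0 = g.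
Proof. by apply/rowP => i; rewrite heis_mulE !entryE; ring. Qed.

Lemma test_rhs_eq (q : V) x y : q 0 j0 = x -> q 0 j1 = y ->
  test_rhs q = bas j0 + x *: bas j1 + y *: bas j3 + (x * x) *: bas j4.
Proof. by move=> <- <-. Qed.

Variable C : cfcoef R.
Local Notation a := (ca C).
Local Notation s := (al1 C + al2 C).

Lemma test_stage1 h : stage1 h O = bas j0 :> V.
Proof.
rewrite -[LHS]/(test_rhs (heis_mul 0 0)) heis_mulr0.
by rewrite (@test_rhs_eq _ 0 0) ?row_zeroE // mul0r !scale0r !addr0.
Qed.

Definition test_f2 h : V :=
  bas j0 + (h * a) *: bas j1 + 0 *: bas j3 + (h * a * (h * a)) *: bas j4.

Lemma test_stage2 h : stage2 C h O = test_f2 h :> V.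
Proof.
rewrite -[LHS]/(test_rhs (heis_mul (heis_exp (h *: (a *: (stage1 h O : V)))) 0)).
rewrite heis_mulr0 test_stage1; apply: test_rhs_eq.
  by rewrite heis_expE !entryE !basE /=; ring.
by rewrite heis_expE !entryE !basE /=; ring.
Qed.

Definition test_arg3 h : V := al1 C *: bas j0 + al2 C *: test_f2 h.

Lemma test_g3 h : g3 C h O = heis_exp (h *: test_arg3 h) :> V.
Proof.
rewrite -[LHS]/(heis_exp (h *: (al1 C *: (stage1 h O : V) + al2 C *: (stage2 C h O : V)))).
by rewrite test_stage1 test_stage2.
Qed.

Definition test_f3 h : V := bas j0 + (h * s) *: bas j1 + (h ^+ 2 * (al2 C * a)) *: bas j3
  + (h * s * (h * s)) *: bas j4.

Lemma test_stage3 h : stage3 C h O = test_f3 h :> V.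
Proof.
rewrite -[LHS]/(test_rhs (heis_mul (g3 C h O : V) 0)).
rewrite heis_mulr0 test_g3; apply: test_rhs_eq.
  by rewrite heis_expE /test_arg3 /test_f2 !entryE !basE /=; ring.
by rewrite heis_expE /test_arg3 /test_f2 !entryE !basE /=; ring.
Qed.

Definition test_arg4 h : V := be1 C *: bas j0 + be2 C *: test_f2 h + be3 C *: test_f3 h.

Lemma test_update h :
  update C h O = heis_mul (heis_exp (h *: test_arg3 h)) (heis_exp (h *: test_arg4 h)) :> V.
Proof.
rewrite -[LHS]/(heis_mul (heis_mul (g3 C h O : V) (heis_exp (h *:
  (be1 C *: (stage1 h O : V) + be2 C *: (stage2 C h O : V) + be3 C *: (stage3 C h O : V))))) 0).
by rewrite heis_mulr0 test_stage1 test_stage2 test_stage3 test_g3.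
Qed.

Local Notation t := (be1 C + be2 C + be3 C).
Local Notation A := (al2 C * a).
Local Notation B := (be2 C * a + be3 C * s).

(** These are exact values, not asymptotic ones. Each coordinate is one monomial in h, to be
    compared with the same power in [test_solution_coords]. *)
Lemma test_update_coords h :
  [/\ (update C h O : V) 0 j0 = h * (s + t),
      (update C h O : V) 0 j1 = h ^+ 2 * (A + B),
      (update C h O : V) 0 j2 = h ^+ 3 * (s * A / 2 + t * B / 2 + s * B),
      (update C h O : V) 0 j3 = h ^+ 3 * (be3 C * A) &
      (update C h O : V) 0 j4 =
        h ^+ 3 * ((al2 C + be2 C) * a ^+ 2 + be3 C * s ^+ 2)].
Proof.
rewrite test_update; split; rewrite heis_mulE !heis_expE;
  rewrite /test_arg3 /test_arg4 /test_f2 /test_f3 !entryE !basE /=.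
all: by field.
Qed.

Lemma test_solution_coords h :
  [/\ (test_solution h : V) 0 j0 = h, (test_solution h : V) 0 j1 = h ^+ 2 / 2,
      (test_solution h : V) 0 j2 = h ^+ 3 / 6, (test_solution h : V) 0 j3 = h ^+ 3 / 6 &
      (test_solution h : V) 0 j4 = h ^+ 3 / 3].
Proof.
split; rewrite /test_solution /cubic !entryE !basE /=.
all: by field.
Qed.

Lemma smooth_coordinate j : smooth_fun (M := rV_manifold 5) (fun v : V => v 0 j).
Proof.
by move=> _ ->; apply: smooth_on_coord; [exact: openT|exact: smooth_on_id].
Qed.

Lemma order_test q (step : method) j : has_order q step ->
  Oh q.+1 (fun h : R => (test_solution h : V) 0 j - (step TP h O : V) 0 j).
Proof.
move=> H; have := H TP O test_solution (fun v : V => v 0 j) test_solutionP.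
by move=> /(_ (@smooth_coordinate j)) /eqO_Oh.
Qed.

Lemma Oh_order_eq q k (x y : R) (g1 g2 : R -> R) : (k <= q)%N ->
  Oh q.+1 (fun h => g1 h - g2 h) ->
  (forall h, g1 h = h ^+ k * x) -> (forall h, g2 h = h ^+ k * y) -> y = x.
Proof.
move=> kq H e1 e2; apply/esym/eqP; rewrite -subr_eq0; apply/eqP.
apply: (@Oh_monomial_eq0 k); apply: (Oh_le (_ : (k < q.+1)%N)) => //.
by apply: Oh_near H; near=> h; rewrite e1 e2 mulrBr.
Unshelve. all: by end_near. Qed.

Lemma order3_necessary : has_order 3 (update C) -> order3_conditions C.
Proof.
move=> H.
have k1 : s + t = 1.
  apply: (@Oh_order_eq 3 1 _ _ _ _ isT (order_test j0 H)) => h.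
    by have [-> _ _ _ _] := test_solution_coords h; rewrite mulr1 expr1.
  by have [-> _ _ _ _] := test_update_coords h; rewrite expr1.
have k2 : A + B = 1 / 2.
  apply: (@Oh_order_eq 3 2 _ _ _ _ isT (order_test j1 H)) => h.
    by have [_ -> _ _ _] := test_solution_coords h; rewrite mul1r.
  by have [_ -> _ _ _] := test_update_coords h.
have k3 : s * A / 2 + t * B / 2 + s * B = 1 / 6.
  apply: (@Oh_order_eq 3 3 _ _ _ _ isT (order_test j2 H)) => h.
    by have [_ _ -> _ _] := test_solution_coords h; rewrite mul1r.
  by have [_ _ -> _ _] := test_update_coords h.
have k4 : be3 C * A = 1 / 6.
  apply: (@Oh_order_eq 3 3 _ _ _ _ isT (order_test j3 H)) => h.
    by have [_ _ _ -> _] := test_solution_coords h; rewrite mul1r.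
  by have [_ _ _ -> _] := test_update_coords h.
have k5 : (al2 C + be2 C) * a ^+ 2 + be3 C * s ^+ 2 = 1 / 3.
  apply: (@Oh_order_eq 3 3 _ _ _ _ isT (order_test j4 H)) => h.
    by have [_ _ _ _ ->] := test_solution_coords h; rewrite mul1r.
  by have [_ _ _ _ ->] := test_update_coords h.
split => //.
  by rewrite -k2; ring.
(* Once t and B are eliminated, the products s A cancel in the Heisenberg equation, which becomes
   linear in A and s. *)
move: k1 k2 k3; set b := B; set d := A; set u := s; set v := t => k1 k2 k3.
have ev : v = 1 - u by rewrite -k1; ring.
have eb : b = 1 / 2 - d by rewrite -k2; ring.
move: k3; rewrite ev eb => k3.
have -> : 6 * d = 1 + 3 * u - 12 *
    (u * d / 2 + (1 - u) * (1 / 2 - d) / 2 + u * (1 / 2 - d) - 1 / 6) by field.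
by rewrite k3; ring.
Qed.

(** The order 2 conditions are read off coordinates 0 and 1, so the contribution in coordinate 4 is
    hidden in [r]. *)
Lemma test_stage4 h : s + t = 1 -> exists r : V,
  (stage4 C h O : V) = bas j0 + h *: bas j1 + (h ^+ 2 * (A + B)) *: bas j3 + r /\
  r 0 j0 = 0 /\ r 0 j1 = 0.
Proof.
move=> k1; exists ((h * h) *: bas j4); split; last by rewrite !row_scaleE !basE !mulr0.
rewrite -[LHS]/(test_rhs (update C h O : V)).
have [e0 e1 _ _ _] := test_update_coords h.
by rewrite k1 mulr1 in e0; apply: test_rhs_eq.
Qed.

Lemma order2_necessary (bh : 'rV[R]_4) : s + t = 1 ->
  has_order 2 (embedded C bh) -> classical_order2 bh (abscissae C).
Proof.
move=> k1 H; apply/classical_order2E.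
have E h : (embedded C bh h O : V) = heis_exp (h *: (bh 0 0 *: bas j0 +
    bh 0 1 *: test_f2 h + bh 0 2 *: test_f3 h + bh 0 3 *: (stage4 C h O : V))).
  rewrite -[LHS]/(heis_mul (heis_exp (h *: (bh 0 0 *: (stage1 h O : V) +
    bh 0 1 *: (stage2 C h O : V) + bh 0 2 *: (stage3 C h O : V) + bh 0 3 *: (stage4 C h O : V)))) 0).
  by rewrite heis_mulr0 test_stage1 test_stage2 test_stage3.
split.
  apply: (@Oh_order_eq 2 1 _ _ _ _ isT (order_test j0 H)) => h.
    by have [-> _ _ _ _] := test_solution_coords h; rewrite mulr1 expr1.
  have [r [e4 [r0 r1]]] := test_stage4 h k1.
  by rewrite E e4 heis_expE /test_f2 /test_f3 !entryE r0 !basE /=; ring.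
apply: (@Oh_order_eq 2 2 _ _ _ _ isT (order_test j1 H)) => h.
  by have [_ -> _ _ _] := test_solution_coords h; rewrite mul1r.
have [r [e4 [r0 r1]]] := test_stage4 h k1.
by rewrite E e4 heis_expE /test_f2 /test_f3 !entryE r0 r1 !basE /=; ring.
Qed.

End Necessity.

Local Close Scope classical_set_scope.

(** * Solving the order conditions *)

Section OrderConditions.
Context {R : realType}.
Implicit Types (C : cfcoef R) (a w : R).

Lemma order3P C : has_order 3 (update C) <-> order3_conditions C.
Proof. by split; [exact: order3_necessary|exact: order3_sufficient]. Qed.

Definition omega_eq a w := 36 * w ^+ 2 + (9 * a - 30) * w + (3 * a + 1).

Lemma root_omega_poly a w : root (omega_poly a) w <-> omega_eq a w = 0.
Proof.
rewrite /root (_ : (omega_poly a).[w] = omega_eq a w).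
  by split=> /eqP.
by rewrite !(hornerD, hornerZ, hornerXn, hornerX, hornerC).
Qed.

(** The solution of the conditions in terms of a and w before the quadratic reshapes it; no
    denominator 3a + 1 occurs, so it covers a = -1/3 as well. *)
Definition solved_coef w C : Prop :=
  [/\ al2 C = w / ca C, al1 C = (6 * w - 1) / 3 - w / ca C,
      be3 C = (6 * w)^-1,
      be2 C = (1 / 2 - (6 * w)^-1 * ((6 * w - 1) / 3)) / ca C - w / ca C &
      be1 C = 1 - (6 * w - 1) / 3 - be2 C - be3 C].

Lemma order3_solved C : order3_conditions C ->
  [/\ ca C != 0, al2 C * ca C != 0, omega_eq (ca C) (al2 C * ca C) = 0 &
      solved_coef (al2 C * ca C) C].
Proof.
move=> [k1 k2 k3 k4 k5]; set w := al2 C * ca C.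
have bw0 : be3 C * w != 0 by rewrite k4 mulf_neq0 ?invr_neq0.
have w0 : w != 0 by apply: contraNneq bw0 => ->; rewrite mulr0.
have a0 : ca C != 0 by apply: contraNneq w0 => e; rewrite /w e mulr0.
have b3 : be3 C = (6 * w)^-1.
  by apply: (mulIf w0); rewrite k4; field; rewrite w0.
have c3 : al1 C + al2 C = (6 * w - 1) / 3 by rewrite k5; field.
have al2E : al2 C = w / ca C by rewrite /w mulfK.
have Q : omega_eq (ca C) w = 0.
  (* Subtracting the third condition from a times the second eliminates the weight of f2; multiplied
     by 54 w, this becomes the quadratic. *)
  have q : be3 C * (al1 C + al2 C) * (ca C - (al1 C + al2 C)) = ca C / 2 - 1 / 3.
    rewrite -k3; have -> : ca C / 2 = ca C * (1 / 2) by field.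
    by rewrite -k2; ring.
  move: q; rewrite b3 c3 => q.
  have -> : omega_eq (ca C) w = 54 * w * (ca C / 2 - 1 / 3 -
      (6 * w)^-1 * ((6 * w - 1) / 3) * (ca C - (6 * w - 1) / 3)).
    by rewrite /omega_eq; field; rewrite w0.
  by rewrite q subrr mulr0.
split => //; split => //.
- by rewrite -c3 -al2E addrK.
- rewrite -al2E; have -> : 1 / 2 - (6 * w)^-1 * ((6 * w - 1) / 3) = (al2 C + be2 C) * ca C.
    by rewrite -k2 b3 c3 addrK.
  by rewrite mulfK // addrC addKr.
- by rewrite -c3 -k1; ring.
Qed.

Lemma order3_general C : 3 * ca C + 1 != 0 -> order3_conditions C ->
  ca C != 0 /\ exists2 w, root (omega_poly (ca C)) w & general_coef w C.
Proof.
move=> a1 /order3_solved[a0 w0 Q]; set w := al2 C * ca C in w0 Q *.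
move=> [e1 e2 e3 e4 e5]; split=> //; exists w; first exact/root_omega_poly.
(* The quadratic in the form that exchanges the divisor w of [be3] for 3a + 1. *)
have a1E : 3 * ca C + 1 = w * (30 - 9 * ca C - 36 * w).
  by apply/eqP; rewrite -subr_eq0 -Q /omega_eq; apply/eqP; ring.
have f0 : 30 - 9 * ca C - 36 * w != 0.
  by apply: contraNneq a1 => e; rewrite a1E e mulr0.
have w2 : w ^+ 2 = - ((9 * ca C - 30) * w + (3 * ca C + 1)) / 36.
  have -> : - ((9 * ca C - 30) * w + (3 * ca C + 1)) / 36 = w ^+ 2 - omega_eq (ca C) w / 36.
    by rewrite /omega_eq; field.
  by rewrite Q mul0r subr0.
have b3 : be3 C = (- 12 * w - 3 * ca C + 10) / (2 * (3 * ca C + 1)).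
  by rewrite e3 a1E; field; rewrite f0 w0.
have b2 : be2 C = (- 18 * w * (1 + ca C) + 11) / (6 * ca C * (3 * ca C + 1)).
  rewrite e4 -e3 b3.
  apply/eqP; rewrite -subr_eq0; apply/eqP.
  (* The two sides differ by a multiple of the quadratic, given here with its cofactor. *)
  transitivity (- omega_eq (ca C) w * (- 2) / (6 * ca C * (3 * ca C + 1))).
    by rewrite /omega_eq; field; rewrite a1 a0.
  by rewrite Q oppr0 !mul0r.
split=> //; first by rewrite e2; field.
by rewrite e5 b2 b3; field; rewrite a0 a1.
Qed.

(** Each condition is either an identity in a and w or fails to be one by an explicit multiple of
    the quadratic. *)
Lemma general_order3 C w : 3 * ca C + 1 != 0 -> ca C != 0 ->
  root (omega_poly (ca C)) w -> general_coef w C -> order3_conditions C.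
Proof.
move=> a1 a0 /root_omega_poly Q [e1 e2 e3 e4 e5].
have c3 : al1 C + al2 C = (6 * w - 1) / 3 by rewrite e1 e2; field.
have w1 : al2 C * ca C = w by rewrite e2 mulfVK.
split.
- by rewrite c3 e3 e4 e5; field; rewrite a0 a1.
- apply/eqP; rewrite -subr_eq0; apply/eqP.
  transitivity (- omega_eq (ca C) w / (3 * (3 * ca C + 1))).
    by rewrite c3 e2 e4 e5 /omega_eq; field; rewrite a0 a1.
  by rewrite Q oppr0 mul0r.
- apply/eqP; rewrite -subr_eq0; apply/eqP.
  transitivity (omega_eq (ca C) w * (2 - 6 * w) / (9 * (3 * ca C + 1))).
    by rewrite c3 e2 e4 e5 /omega_eq; field; rewrite a0 a1.
  by rewrite Q !mul0r.
- apply/eqP; rewrite -subr_eq0; apply/eqP.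
  transitivity (- omega_eq (ca C) w / (6 * (3 * ca C + 1))).
    by rewrite w1 e5 /omega_eq; field; rewrite a1.
  by rewrite Q oppr0 mul0r.
- by rewrite w1 c3; field.
Qed.

(** Here the quadratic is w (36 w - 33), and w is nonzero, so w = 11/12. *)
Lemma order3_special C : ca C = - 1 / 3 ->
  (order3_conditions C <-> special_coef C).
Proof.
move=> aE; split=> [/order3_solved[a0 w0 Q]|[e1 e2 e3 e4 e5]]; last first.
  by split; rewrite ?aE ?e1 ?e2 ?e3 ?e4 ?e5; field.
set w := al2 C * ca C in w0 Q * => -[e1 e2 e3 e4 e5].
have wE : w = 11 / 12.
  move: Q; rewrite /omega_eq aE => Q.
  have : w * (36 * w - 33) = 0 by rewrite -Q; field.
  move/eqP; rewrite mulf_eq0 (negbTE w0) /= subr_eq0 => /eqP e.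
  by apply: (mulfI (_ : 36 != 0 :> R)) => //; rewrite e; field.
move: e1 e2 e3 e4 e5; rewrite wE aE => e1 e2 e3 e4 e5.
have E1 : al1 C = 17 / 4 by rewrite e2; field.
have E2 : al2 C = - 11 / 4 by rewrite e1; field.
have E3 : be3 C = 2 / 11 by rewrite e3; field.
have E4 : be2 C = 91 / 44 by rewrite e4; field.
by split=> //; rewrite e5 E3 E4; field.
Qed.

Lemma order2P C (bh : 'rV[R]_4) : has_order 3 (update C) ->
  (has_order 2 (embedded C bh) <-> classical_order2 bh (abscissae C)).
Proof.
move=> /order3P[k1 _ _ _ _]; split.
  exact: order2_necessary.
exact: order2_sufficient.
Qed.

(** The trapezoidal weights on f1 and f4, a solution for every scheme since their abscissae are 0
    and 1. *)
Definition ord2_shift : 'rV[R]_4 := \row_k nth 0 [:: 1 / 2; 0; 0; 1 / 2] k.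

(** Each row adds weight 1 to f2 or f3 and corrects f4 and f1 so that both sums stay unchanged. *)
Definition ord2_directions C : 'M[R]_(2, 4) :=
  \matrix_(i, k) nth 0 (nth [::]
    [:: [:: ca C - 1; 1; 0; - ca C];
        [:: al1 C + al2 C - 1; 0; 1; - (al1 C + al2 C)]] i) k.

Lemma rank_ord2_directions C : \rank (ord2_directions C) = 2%N.
Proof.
apply/eqP; apply/row_freeP.
(* This right inverse selects the columns of f2 and f3, which form an identity block. *)
exists (\matrix_(i < 4, k < 2) (i == k.+1 :> nat)%:R).
apply/matrixP => i k; rewrite !mxE sum4 !mxE /=.
by case: i k => [[|[|//]] ?] [[|[|//]] ?] /=; rewrite -?val_eqE /=; ring.
Qed.

Lemma sum2 (F : 'I_2 -> R) : \sum_k F k = F 0 + F 1.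
Proof.
rewrite !big_ord_recl big_ord0 addr0.
by congr (F _ + F _); apply/val_inj.
Qed.

Lemma classical_order2_family C (bh : 'rV[R]_4) :
  classical_order2 bh (abscissae C) <->
  exists u : 'rV[R]_2, bh = ord2_shift + u *m ord2_directions C.
Proof.
rewrite classical_order2E; split=> [[e1 e2]|[u ->]].
  exists (\row_k nth 0 [:: bh 0 1; bh 0 2] k); apply/rowP => k.
  rewrite !mxE sum2 !mxE /=.
  have e3 : bh 0 3 = 1 / 2 - bh 0 1 * ca C - bh 0 2 * (al1 C + al2 C) by rewrite -e2; ring.
  have e0 : bh 0 0 = 1 - bh 0 1 - bh 0 2 - bh 0 3 by rewrite -e1; ring.
  have [->|->|->|->] : [\/ k = 0, k = 1, k = 2 | k = 3].
    case: k => [[|[|[|[|//]]]] kP];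
      [apply: Or41|apply: Or42|apply: Or43|apply: Or44]; exact/val_inj.
  - by rewrite e0 e3 /=; field.
  - by rewrite /=; ring.
  - by rewrite /=; ring.
  - by rewrite e3 /=; field.
by rewrite !mxE !sum2 !mxE /=; split; field.
Qed.

(** * Rationality of the coefficients *)

Lemma is_rationalD (x y : R) : is_rational x -> is_rational y -> is_rational (x + y).
Proof. by move=> [r ->] [s ->]; exists (r + s); rewrite rmorphD. Qed.

Lemma is_rationalN (x : R) : is_rational x -> is_rational (- x).
Proof. by move=> [r ->]; exists (- r); rewrite rmorphN. Qed.

Lemma is_rationalM (x y : R) : is_rational x -> is_rational y -> is_rational (x * y).
Proof. by move=> [r ->] [s ->]; exists (r * s); rewrite rmorphM. Qed.

Lemma is_rationalV (x : R) : is_rational x -> is_rational x^-1.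
Proof. by move=> [r ->]; exists r^-1; rewrite fmorphV. Qed.

Lemma is_rational_nat n : is_rational (n%:R : R).
Proof. by exists n%:R; rewrite ratr_nat. Qed.

(* The numerals are variables lest unification unfold large constants. *)
Lemma ratr_disc (i j k : nat) (r : rat) :
  ratr (i%:R * r ^+ 2 - j%:R * r + k%:R) =
  i%:R * ratr r ^+ 2 - j%:R * ratr r + k%:R :> R.
Proof. by rewrite rmorphD rmorphB rmorphM rmorphXn rmorphM /= !ratr_nat. Qed.

Lemma ratr_linear (i j k : nat) (x y : rat) :
  ratr (i%:R * x + j%:R * y - k%:R) =
  i%:R * ratr x + j%:R * ratr y - k%:R :> R.
Proof. by rewrite rmorphB rmorphD !rmorphM /= !ratr_nat. Qed.

Lemma rational_coef_solved C : order3_conditions C ->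
  is_rational (ca C) -> is_rational (al2 C * ca C) -> rational_coef C.
Proof.
move=> /order3_solved[a0 w0 Q]; set w := al2 C * ca C in w0 Q *.
move=> [e1 e2 e3 e4 e5] ra rw.
have rN n : is_rational (n%:R : R) := is_rational_nat n.
have rB (x y : R) (rx : is_rational x) (ry : is_rational y) : is_rational (x - y).
  exact: (is_rationalD rx (is_rationalN ry)).
have rc : is_rational ((6 * w - 1) / 3).
  exact: (is_rationalM (rB _ _ (is_rationalM (rN 6) rw) (rN 1%N)) (is_rationalV (rN 3))).
have r2 : is_rational (w / ca C) := is_rationalM rw (is_rationalV ra).
have r3 : is_rational (6 * w)^-1 := is_rationalV (is_rationalM (rN 6) rw).
have rh : is_rational (1 / 2 : R) := is_rationalM (rN 1%N) (is_rationalV (rN 2)).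
have rb2 : is_rational (be2 C).
  rewrite e4.
  exact: (rB _ _ (is_rationalM (rB _ _ rh (is_rationalM r3 rc)) (is_rationalV ra)) r2).
split; split.
- exact: ra.
- by rewrite e2; exact: (rB _ _ rc r2).
- by rewrite e1; exact: r2.
- rewrite e5 e3; exact: (rB _ _ (rB _ _ (rB _ _ (rN 1%N) rc) rb2) r3).
- exact: rb2.
- by rewrite e3; exact: r3.
Qed.

(** Completing the square, (72 w + 9 a - 30)^2 is the discriminant, so w is rational exactly when
    the discriminant is a rational square; a and w determine the other coefficients rationally. *)
Lemma rational_coefP (r : rat) C : ca C = ratr r -> order3_conditions C ->
  (rational_coef C <-> exists s : rat, 81 * r ^+ 2 - 972 * r + 756 = s ^+ 2).
Proof.
move=> aE ok; have [a0 w0 Q _] := order3_solved ok.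
set w := al2 C * ca C in w0 Q *.
have disc : (72 * w + 9 * ca C - 30) ^+ 2 = 81 * ca C ^+ 2 - 972 * ca C + 756.
  have -> : (72 * w + 9 * ca C - 30) ^+ 2 =
    144 * omega_eq (ca C) w + (81 * ca C ^+ 2 - 972 * ca C + 756) by rewrite /omega_eq; ring.
  by rewrite Q mulr0 add0r.
have discr : 81 * ca C ^+ 2 - 972 * ca C + 756 = ratr (81 * r ^+ 2 - 972 * r + 756).
  by rewrite aE; exact/esym/ratr_disc.
split=> [[[_ _ [al ale]] _]|[s es]].
  exists (72 * (al * r) + 9 * r - 30).
  have e : ratr (81 * r ^+ 2 - 972 * r + 756) =
      ratr ((72 * (al * r) + 9 * r - 30) ^+ 2) :> R.
    rewrite -discr -disc rmorphXn /=; congr (_ ^+ 2).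
    by rewrite ratr_linear rmorphM /w ale aE.
  exact: (fmorph_inj _ e).
have ra : is_rational (ca C) by exists r.
have rN n : is_rational (n%:R : R) := is_rational_nat n.
have rs : is_rational (ratr s : R) by exists s.
have r9 := is_rationalN (is_rationalM (rN 9) ra).
have rw : is_rational w.
  have : (72 * w + 9 * ca C - 30) ^+ 2 = (ratr s) ^+ 2.
    by rewrite disc discr es rmorphXn.
  move/eqP; rewrite eqf_sqr => /orP[] /eqP e.
    have -> : w = (ratr s + - (9 * ca C) + 30) * 72^-1 by rewrite -e; field.
    exact: (is_rationalM (is_rationalD (is_rationalD rs r9) (rN 30)) (is_rationalV (rN 72))).
  have -> : w = (- ratr s + - (9 * ca C) + 30) * 72^-1 by rewrite -e; field.
  exact: (is_rationalM (is_rationalD (is_rationalD (is_rationalN rs) r9) (rN 30))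
    (is_rationalV (rN 72))).
exact: (rational_coef_solved ok ra rw).
Qed.

(** The p-adic valuation is even on the left-hand side and odd on the right-hand side. *)
Lemma square_ratio_logn (p m n d : nat) : (0 < n)%N -> (0 < d)%N ->
  logn p m = 1%N -> (n ^ 2 = m * d ^ 2)%N -> False.
Proof.
move=> n0 d0 lm e; have m0 : (0 < m)%N.
  by move: lm; case: (m) => //; rewrite logn0.
have d2 : (0 < d ^ 2)%N by rewrite expn_gt0 d0.
have := congr1 odd (congr1 (logn p) e).
by rewrite lognX lognM // lm lognX oddD !oddM.
Qed.

Lemma square_neq_756 (s : rat) : s ^+ 2 != 756.
Proof.
apply/eqP => e.
have d0 : (denq s)%:~R != 0 :> rat by rewrite intr_eq0 denq_neq0.
have eqz : numq s ^+ 2 = 756%N%:Z * denq s ^+ 2.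
  apply: (@intr_inj rat); rewrite rmorphXn rmorphM rmorphXn /= -pmulrn -e.
  by rewrite -exprMn -{2}(divq_num_den s) mulfVK.
have eqn : (`|numq s| ^ 2 = 756 * `|denq s| ^ 2)%N.
  by have := congr1 absz eqz; rewrite abszM !abszX absz_nat.
have n0 : (0 < `|numq s|)%N.
  rewrite absz_gt0; apply/eqP => n0; move/esym/eqP: e.
  by rewrite -{1}(divq_num_den s) n0 mulr0z mul0r expr0n /= pnatr_eq0.
have dd0 : (0 < `|denq s|)%N by rewrite absz_gt0 denq_neq0.
(* Indeed 756 = 2^2 * 3^3 * 7. *)
have l7 : logn 7 756 = 1%N by vm_compute.
exact: (square_ratio_logn n0 dd0 l7 eqn).
Qed.

Definition general_cfcoef a w : cfcoef R :=
  CFCoef a ((6 * a * w - 3 * w - a) / (3 * a)) (w / a)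
    ((- 12 * a * w + 18 * w + 11 * a - 11) / (6 * a))
    ((- 18 * w * (1 + a) + 11) / (6 * a * (3 * a + 1)))
    ((- 12 * w - 3 * a + 10) / (2 * (3 * a + 1))).

Lemma general_cfcoef_order3 a w : a != 0 -> 3 * a + 1 != 0 -> omega_eq a w = 0 ->
  has_order 3 (update (general_cfcoef a w)).
Proof.
move=> a0 a1 Q; apply/order3P; apply: (@general_order3 _ w) => //.
exact/root_omega_poly.
Qed.

Lemma disc_cancel (i j k m : nat) : (i * m = j)%N ->
  i%:R * m%:R ^+ 2 - j%:R * m%:R + k%:R = k%:R :> rat.
Proof. by move=> <-; rewrite natrM expr2 mulrA subrr add0r. Qed.

(* For a = 12 the discriminant is 756 = 7 * 108, not a square. *)
Lemma irrational_example : exists (r : rat) (C : cfcoef R),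
  [/\ ca C = ratr r, has_order 3 (update C) & ~ rational_coef C].
Proof.
pose w : R := (Num.sqrt 756 - 78) / 72.
have s2 : Num.sqrt 756 ^+ 2 = 756 :> R by exact: sqr_sqrtr (ler0n _ _).
have H : has_order 3 (update (general_cfcoef 12 w)).
  apply: general_cfcoef_order3.
  - by rewrite pnatr_eq0.
  - by rewrite -natrM natr1 pnatr_eq0.
  have -> : omega_eq 12 w = (Num.sqrt 756 ^+ 2 - 756) / 144 by rewrite /omega_eq /w; field.
  by rewrite s2 subrr mul0r.
have aE : ca (general_cfcoef 12 w) = ratr 12 by rewrite ratr_nat.
exists 12, (general_cfcoef 12 w); split; [exact: aE|exact: H|].
move=> /(rational_coefP aE ((order3P _).1 H))[s es].
have := disc_cancel 756 (erefl (81 * 12)%N); rewrite es => /eqP.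
by rewrite (negbTE (square_neq_756 s)).
Qed.

Lemma rational_pair (r : rat) C : ca C = ratr r -> has_order 3 (update C) ->
  rational_coef C ->
  exists (C : cfcoef R) (bh : 'rV[R]_4),
    [/\ ca C = ratr r, has_order 3 (update C), has_order 2 (embedded C bh),
        rational_coef C & forall k, is_rational (bh 0 k)].
Proof.
move=> aE H rC; exists C, ord2_shift; split=> //.
- apply/order2P => //; apply/classical_order2_family; exists 0.
  by rewrite mul0mx addr0.
move=> k; rewrite mxE.
have h : is_rational (1 / 2 : R) :=
  is_rationalM (is_rational_nat 1) (is_rationalV (is_rational_nat 2)).
have z : is_rational (0 : R) by exact: (is_rational_nat 0).
by case: k => [[|[|[|[|//]]]] kP]; rewrite /=; [exact: h|exact: z|exact: z|exact: h].
Qed.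

(** Positivity makes a and 3a + 1 nonzero, so the general formulas apply, and a rational root w
    makes all coefficients rational. *)
Lemma rational_pair_general (r : rat) (a w : R) : ratr r = a -> 0 < a ->
  is_rational w -> omega_eq a w = 0 ->
  exists (C : cfcoef R) (bh : 'rV[R]_4),
    [/\ ca C = ratr r, has_order 3 (update C), has_order 2 (embedded C bh),
        rational_coef C & forall k, is_rational (bh 0 k)].
Proof.
move=> aE a_gt0 rw Q; have a0 : a != 0 by exact: lt0r_neq0.
have H : has_order 3 (update (general_cfcoef a w)).
  by apply: general_cfcoef_order3 => //; apply: lt0r_neq0; rewrite addr_gt0 ?mulr_gt0.
apply: (@rational_pair r (general_cfcoef a w)) => //.
apply: rational_coef_solved; first exact/order3P.
  by exists r.
by rewrite /= mulfVK.
Qed.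

Lemma ratr_frac (p q : nat) : ratr (p%:R / q%:R) = p%:R / q%:R :> R.
Proof. by rewrite rmorphM fmorphV /= !ratr_nat. Qed.

Lemma is_rational_frac (p q : nat) : is_rational (p%:R / q%:R : R).
Proof. by exists (p%:R / q%:R); rewrite ratr_frac. Qed.

End OrderConditions.

Theorem mainTheorem2 (R : realType) :
  (* the general update of order 3 *)
  (forall C : cfcoef R, 3 * ca C + 1 != 0 ->
     (has_order 3 (update C) <->
      ca C != 0 /\
      exists2 w : R, root (omega_poly (ca C)) w & general_coef w C)) /\
  (forall C : cfcoef R, ca C = - 1 / 3 ->
     (has_order 3 (update C) <-> special_coef C)) /\
  (forall (C : cfcoef R) (w : R), ca C != 0 -> 3 * ca C + 1 != 0 ->
     root (omega_poly (ca C)) w -> general_coef w C ->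
     al1 C + al2 C = (6 * w - 1) / 3) /\
  (* the embedded approximation of order 2 *)
  (forall C : cfcoef R, has_order 3 (update C) ->
     (forall bh : 'rV[R]_4,
        has_order 2 (embedded C bh) <-> classical_order2 bh (abscissae C)) /\
     exists (b0 : 'rV[R]_4) (D : 'M[R]_(2, 4)), \rank D = 2%N /\
       forall bh : 'rV[R]_4,
         has_order 2 (embedded C bh) <-> exists u : 'rV[R]_2, bh = b0 + u *m D) /\
  (* rationality of the coefficients *)
  (forall a : R, (9 * a - 30) ^+ 2 - 4 * 36 * (3 * a + 1) =
                 81 * a ^+ 2 - 972 * a + 756) /\
  (forall (r : rat) (C : cfcoef R), ca C = ratr r -> has_order 3 (update C) ->
     (rational_coef C <->
      exists s : rat, 81 * r ^+ 2 - 972 * r + 756 = s ^+ 2)) /\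
  (exists (r : rat) (C : cfcoef R),
     [/\ ca C = ratr r, has_order 3 (update C) & ~ rational_coef C]) /\
  (forall r : rat,
     r \in [:: - 1 / 3; 1 / 3; 2 / 3; 7 / 9; 101 / 9; 34 / 3; 35 / 3] ->
     exists (C : cfcoef R) (bh : 'rV[R]_4),
       [/\ ca C = ratr r, has_order 3 (update C), has_order 2 (embedded C bh),
           rational_coef C & forall k, is_rational (bh 0 k)]).
Proof.
split; [|split; [|split; [|split; [|split; [|split; [|split]]]]]].
- move=> C a1; rewrite order3P; split; first exact: order3_general.
  by move=> [a0 [w rw gw]]; exact: general_order3 a1 a0 rw gw.
- by move=> C aE; rewrite order3P; exact: order3_special.
- by move=> C w a0 a1 _ [-> -> _ _ _]; field.
- move=> C H; split=> [bh|]; first exact: order2P.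
  exists ord2_shift, (ord2_directions C); split; first exact: rank_ord2_directions.
  by move=> bh; rewrite (order2P bh H); exact: classical_order2_family.
- by move=> a; ring.
- by move=> r C aE /order3P; exact: rational_coefP.
- exact: irrational_example.
move=> r; rewrite in_cons => /predU1P[rE|].
  (* At a = -1/3 the special solution is taken, for which w = 11/12. *)
  pose C : cfcoef R := CFCoef (- 1 / 3) (17 / 4) (- 11 / 4) (- 11 / 4) (91 / 44) (2 / 11).
  have aE : ca C = ratr r.
    by rewrite rE /= [RHS]rmorphM rmorphN fmorphV /= rmorph1 ratr_nat.
  have H : has_order 3 (update C) by apply/order3P/order3_special.
  apply: (rational_pair aE H); apply: rational_coef_solved; first exact/order3P.
    by exists r.
  have -> : al2 C * ca C = 11%:R / 12%:R by rewrite /=; field.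
  exact: is_rational_frac.
have pos (p q : nat) : (0 < p)%N -> (0 < q)%N -> 0 < p%:R / q%:R :> R.
  by move=> p0 q0; rewrite divr_gt0 ?ltr0n.
have neg (p q : nat) : is_rational (- (p%:R / q%:R) : R).
  exact/is_rationalN/is_rational_frac.
have e13 : ratr (1 / 3) = 1 / 3 :> R := ratr_frac 1 3.
rewrite in_cons => /predU1P[->|]; last rewrite in_cons => /predU1P[->|];
  last rewrite in_cons => /predU1P[->|]; last rewrite in_cons => /predU1P[->|];
  last rewrite in_cons => /predU1P[->|]; last rewrite mem_seq1 => /eqP ->.
(* In this and the following cases the last argument fixes a rational root w of the quadratic for
   the given a. *)
- apply: (rational_pair_general e13 (pos 1%N 3%N isT isT) (is_rational_frac 2 3)).
  by rewrite /omega_eq; field.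
- apply: (rational_pair_general (ratr_frac 2 3) (pos 2%N 3%N isT isT) (is_rational_frac 1 2)).
  by rewrite /omega_eq; field.
- apply: (rational_pair_general (ratr_frac 7 9) (pos 7%N 9%N isT isT) (is_rational_frac 5 12)).
  by rewrite /omega_eq; field.
- apply: (rational_pair_general (ratr_frac 101 9) (pos 101%N 9%N isT isT) (neg 8 9)).
  by rewrite /omega_eq; field.
- apply: (rational_pair_general (ratr_frac 34 3) (pos 34%N 3%N isT isT) (neg 5 6)).
  by rewrite /omega_eq; field.
- apply: (rational_pair_general (ratr_frac 35 3) (pos 35%N 3%N isT isT) (neg 3 4)).
  by rewrite /omega_eq; field.
Qed.
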